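(* There is a universal constant $C>0$ such that the following holds. Let $d\ge 1$, let $T\geq 110d^2$, and run the algorithm BISONS (defined in the context) for $T$ rounds with input parameters $B=\frac{264}{5}d\log(T)$, $\eta=\frac{1}{4B}$, $\beta=\frac{11}{7B}$, against an arbitrary sequence of returns vectors $r_1,\dots,r_T\in\Delta([d])$. Let $u\in\Delta([d])$ be any comparator with $\min_{i} u_i\geq T^{-1}$. Then: (1) for every completed epoch (an epoch whose end is triggered by the reset condition), with set of rounds $\mathcal{E}\subseteq\{1,\dots,T\}$, the regret over the epoch is non-positive: $\sum_{t\in\mathcal{E}}(f_t(x_t)-f_t(u))\leq 0$; (2) for the epoch that runs until the end of time $T$ (without reset), with set of rounds $\mathcal{E}$, $\sum_{t\in\mathcal{E}}(f_t(x_t)-f_t(u))\leq C\,d^2\log^2(T)$.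
   Context: Online portfolio problem: $\Delta([d])$ is the probability simplex in $\mathbb{R}^d$. In each round $t=1,\dots,T$ the learner plays $x_t\in\Delta([d])$, then observes a returns vector $r_t\in\Delta([d])$ (arbitrary, possibly adversarial) and suffers the loss $f_t(x_t)$ where $f_t(x)=-\log(\langle x,r_t\rangle)$. Let $R(x)=-\sum_{i=1}^d\log(x_i)$. BISONS with inputs $T,B,\eta,\beta$ operates in epochs. The first epoch starts at round $1$. Within an epoch there is an internal time $\tau=1,2,\dots$, and all quantities below are started afresh in each epoch (nothing is remembered from earlier epochs). Set $p_0=d\mathbf{1}$, $x_1=u_1=\arg\min_{x\in\Delta([d])}R(x)=\frac1d\mathbf 1$, and for all $\tau\ge1$, $i\in[d]$: $p_{\tau,i}=\max\{p_{\tau-1,i},x_{\tau,i}^{-1}\}$ (so $p_1=d\mathbf 1$). In the global round $t$ corresponding to internal time $\tau$ of the current epoch the algorithm plays $x_t=x_\tau$, receives $f_\tau:=f_t$, and forms $$\hat f_\tau(x)=f_\tau(x_\tau)+\langle x-x_\tau,\nabla f_\tau(x_\tau)\rangle+\tfrac{\beta}{2}\langle x-x_\tau,\nabla f_\tau(x_\tau)\rangle^2,\qquad g_\tau(x)=\hat f_\tau(x)-B\langle x,p_\tau-p_{\tau-1}\rangle .$$ It then computes $$x_{\tau+1}=\arg\min_{x\in\Delta([d])}\sum_{s=1}^{\tau}g_s(x)+\eta^{-1}R(x),\qquad u_{\tau+1}=\arg\min_{x\in\Delta([d])}\sum_{s=1}^{\tau}\hat f_s(x)+\eta^{-1}R(x),$$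 and $p_{\tau+1}$. If there is $i\in[d]$ with $2(1+6\eta)\beta\,u_{\tau+1,i}\geq (p_{\tau+1,i})^{-1}$ (the reset condition), the epoch ends with round $t$ (it is a completed epoch) and a new epoch starts in round $t+1$; otherwise $\tau$ is increased by one and the epoch continues. *)

(* Defs.v *)
From HB Require Import structures.
From mathcomp Require Import all_boot all_order all_algebra.
From mathcomp Require Import all_classical all_reals all_analysis.
Set Implicit Arguments.
Unset Strict Implicit.
Unset Printing Implicit Defensive.
Import Order.TTheory GRing.Theory Num.Theory.
Import numFieldNormedType.Exports.
Local Open Scope classical_set_scope.
Local Open Scope ring_scope.

Definition simplex (R : realType) (d : nat) : set 'rV[R]_d :=
  [set x | (forall i, 0 <= x 0 i) /\ \sum_i x 0 i = 1].

Definition dotv (R : realType) (d : nat) (x y : 'rV[R]_d) : R :=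
  \sum_i x 0 i * y 0 i.

(* [ln] is [0] on nonpositive reals. This value is never relevant for points
   of the simplex all of whose coordinates are positive. *)
Definition loss (R : realType) (d : nat) (r x : 'rV[R]_d) : R :=
  - ln (dotv x r).

Definition gradient (R : realType) (d : nat) (f : 'rV[R]_d -> R)
    (x : 'rV[R]_d) : 'rV[R]_d :=
  \row_i derive f x (delta_mx 0 i).

(* Extended-real valued: [barrier x = +oo] on the boundary of the simplex,
   since [lne 0 = -oo]. *)
Definition barrier (R : realType) (d : nat) (x : 'rV[R]_d) : \bar R :=
  (\sum_i - lne (x 0 i)%:E)%E.

(* A minimizer of [F] over the simplex; [get] returns a default value only if
   there is none. *)
Definition argmin_simplex (R : realType) (d : nat) (F : 'rV[R]_d -> \bar R) :
    'rV[R]_d :=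
  get [set x | simplex x /\ forall y, simplex y -> (F x <= F y)%E].

Definition regularized (R : realType) (d : nat) (eta : R)
    (G : 'rV[R]_d -> R) (x : 'rV[R]_d) : \bar R :=
  ((G x)%:E + (eta^-1)%:E * barrier x)%E.

Definition pmax (R : realType) (d : nat) (p x : 'rV[R]_d) : 'rV[R]_d :=
  \row_i Num.max (p 0 i) (x 0 i)^-1.

(* Memory of the algorithm at the start of a round with internal time tau:
   [cumf] and [cumg] are the sums of \hat f_s and of g_s over the internal
   times s < tau of the current epoch, [xcur], [ucur], [pcur] are x_tau, u_tau,
   p_tau, and [pold] is p_(tau-1). *)
Record state (R : realType) (d : nat) := State {
  cumf : 'rV[R]_d -> R;
  cumg : 'rV[R]_d -> R;
  xcur : 'rV[R]_d;
  ucur : 'rV[R]_d;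
  pold : 'rV[R]_d;
  pcur : 'rV[R]_d }.

Definition fhat (R : realType) (d : nat) (beta : R) (f : 'rV[R]_d -> R)
    (xt x : 'rV[R]_d) : R :=
  f xt + dotv (x - xt) (gradient f xt)
  + beta / 2 * dotv (x - xt) (gradient f xt) ^+ 2.

Definition epoch_init (R : realType) (d : nat) : state R d :=
  let x1 := argmin_simplex (@barrier R d) in
  let p0 := const_mx d%:R in
  State (fun=> 0) (fun=> 0) x1 x1 p0 (pmax p0 x1).

(* One increment of the internal time, after receiving the loss [f]. *)
Definition advance (R : realType) (d : nat) (B eta beta : R)
    (f : 'rV[R]_d -> R) (s : state R d) : state R d :=
  let fh := fhat beta f (xcur s) in
  let F := fun x => cumf s x + fh x in
  let G := fun x => cumg s x + (fh x - B * dotv x (pcur s - pold s)) in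
  let x' := argmin_simplex (regularized eta G) in
  let u' := argmin_simplex (regularized eta F) in
  State F G x' u' (pcur s) (pmax (pcur s) x').

Definition reset_cond (R : realType) (d : nat) (eta beta : R)
    (s : state R d) : bool :=
  [exists i, 2 * (1 + 6 * eta) * beta * ucur s 0 i >= (pcur s 0 i)^-1].

(* [bisons B eta beta r k] is the memory after [k] rounds, i.e. at the start of
   round [k.+1]; rounds are numbered from 1, and [r t] is the returns vector of
   round [t]. *)
Fixpoint bisons (R : realType) (d : nat) (B eta beta : R)
    (r : nat -> 'rV[R]_d) (k : nat) : state R d :=
  if k is k'.+1 then
    let s := advance B eta beta (loss (r k)) (bisons B eta beta r k') in
    if reset_cond eta beta s then epoch_init R d else s
  else epoch_init R d.

Definition play (R : realType) (d : nat) (B eta beta : R)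
    (r : nat -> 'rV[R]_d) (t : nat) : 'rV[R]_d :=
  xcur (bisons B eta beta r t.-1).

Definition reset_at (R : realType) (d : nat) (B eta beta : R)
    (r : nat -> 'rV[R]_d) (t : nat) : bool :=
  reset_cond eta beta
    (advance B eta beta (loss (r t)) (bisons B eta beta r t.-1)).

(* No reset occurs in rounds [a], ..., [b.-1], and an epoch starts in round
   [a]: thus the rounds [a], ..., [b] belong to one epoch, starting with [a]. *)
Definition epoch_from (R : realType) (d : nat) (B eta beta : R)
    (r : nat -> 'rV[R]_d) (a b : nat) : Prop :=
  [/\ (1 <= a <= b)%N,
      a = 1%N \/ reset_at B eta beta r a.-1 &
      forall t, (a <= t < b)%N -> ~~ reset_at B eta beta r t].

Definition completed_epoch (R : realType) (d : nat) (B eta beta : R)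
    (r : nat -> 'rV[R]_d) (a b : nat) : Prop :=
  epoch_from B eta beta r a b /\ reset_at B eta beta r b.

Definition unfinished_epoch (R : realType) (d : nat) (B eta beta : R)
    (r : nat -> 'rV[R]_d) (a T : nat) : Prop :=
  epoch_from B eta beta r a T /\ ~~ reset_at B eta beta r T.

Definition regret (R : realType) (d : nat) (B eta beta : R)
    (r : nat -> 'rV[R]_d) (u : 'rV[R]_d) (a b : nat) : R :=
  \sum_(a <= t < b.+1)
    (loss (r t) (play B eta beta r t) - loss (r t) u).

(* Main.v *)
(** Let uh and x be the iterates that the algorithm holds when an epoch ends, and p
    the last value of p before them. As long as no reset has occurred, the
    iterates u grow by a factor at most 3/2 per round, so every surrogate is
    evaluated at uh where its argument beta <uh - x_s, grad f_s> is at least -3/4.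
    There the tangent of the surrogate lies below the true loss f_s, and the
    optimality of uh bounds the comparator loss from below. On the side of x, the
    strong convexity gained at each step (the Bregman divergence D of the
    barrier) is split in two halves: one absorbs the bias B <x, p_s - p_{s-1}> up
    to B log(p_s / p_{s-1}), the other regularizes the quadratic terms, whose sum
    telescopes through a log-determinant, bounded with Hadamard's inequality.
    What remains is at most 11 B d log T - B (<uh, p> + 4 D(uh, x)); a reset at
    the end of the epoch makes the bracket at least 29/100 B, which beats the
    first term. *)
Require Import Defs.
From HB Require Import structures.
From mathcomp Require Import all_boot all_order all_algebra.
From mathcomp Require Import all_classical all_reals all_analysis.
From mathcomp Require Import ring lra zify.
Import Order.TTheory GRing.Theory Num.Theory.
Import numFieldNormedType.Exports.
Local Open Scope ring_scope.
Set Implicit Arguments.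
Unset Strict Implicit.
Unset Printing Implicit Defensive.

(** * Elementary bounds on the logarithm *)

Lemma ln_le_subr1 {R : realType} (x : R) : 0 < x -> ln x <= x - 1.
Proof.
move=> x0; have -> : x = 1 + (x - 1) by ring.
by rewrite [X in _ <= X]addrAC subrr add0r; apply: le_ln1Dx; lra.
Qed.

Lemma ln_ge_subV {R : realType} (x : R) : 0 < x -> 1 - x^-1 <= ln x.
Proof.
move=> x0; have := @ln_le_subr1 R x^-1; rewrite invr_gt0 => /(_ x0).
by rewrite lnV ?posrE //; lra.
Qed.

(** * Positive definite matrices and log-determinants *)

Section PositiveDefinite.
Context {R : realType}.

Definition qform {n} (M : 'M[R]_n) (x : 'cV[R]_n) : R := (x^T *m M *m x) 0 0.

Definition posdef {n} (M : 'M[R]_n) : Prop :=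
  M^T = M /\ forall x, x != 0 -> 0 < qform M x.

Lemma qformDl {n} (M N : 'M[R]_n) x : qform (M + N) x = qform M x + qform N x.
Proof. by rewrite /qform mulmxDr mulmxDl mxE. Qed.

Lemma qform_outer {n} (g x : 'cV[R]_n) : qform (g *m g^T) x = (x^T *m g) 0 0 ^+ 2.
Proof.
rewrite /qform mulmxA -mulmxA.
have -> : g^T *m x = (x^T *m g)^T by rewrite trmx_mul trmxK.
by rewrite (mx11_scalar (x^T *m g)) tr_scalar_mx -scalar_mxM !mxE eqxx mulr1n expr2.
Qed.

Lemma posdefD_outer {n} (M : 'M[R]_n) (g : 'cV[R]_n) :
  posdef M -> posdef (M + g *m g^T).
Proof.
move=> [Ms Mp]; split; first by rewrite linearD /= Ms trmx_mul trmxK.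
by move=> x x0; rewrite qformDl qform_outer ltr_wpDr ?sqr_ge0 ?Mp.
Qed.

Lemma posdef_scalar {n} (c : R) : 0 < c -> posdef (c%:M : 'M[R]_n).
Proof.
move=> c0; split; first by rewrite tr_scalar_mx.
move=> x x0; rewrite /qform mul_mx_scalar -scalemxAl mxE mulr_gt0 //.
have [i xi] : exists i, x i 0 != 0.
  apply/existsP; apply: contra_neqT x0; rewrite negb_exists => /forallP H.
  by apply/matrixP => i j; rewrite ord1 mxE; apply/eqP; move: (H i); rewrite negbK.
rewrite mxE (bigD1 i) //= mxE -expr2 ltr_wpDr ?exprn_even_gt0 //.
by apply: sumr_ge0 => k _; rewrite mxE -expr2 sqr_ge0.
Qed.

(** A unipotent right factor clears the upper right block and leaves the Schur complement of [a] in
    the lower right one. *)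
Lemma posdef_det_block {n} (a : R) (v : 'cV[R]_n) (S : 'M[R]_n) :
  a != 0 ->
  \det (block_mx a%:M v^T v S : 'M[R]_(1 + n)) = a * \det (S - a^-1 *: (v *m v^T)).
Proof.
move=> a0.
have E : block_mx a%:M v^T v S *m block_mx 1%:M (- a^-1 *: v^T) 0 1%:M
    = block_mx a%:M 0 v (S - a^-1 *: (v *m v^T)) :> 'M[R]_(1 + n).
  rewrite mulmx_block !mulmx1 !mulmx0 !addr0 mul_scalar_mx scalerA mulrN divff //.
  by rewrite scaleN1r addNr scaleNr mulmxN -scalemxAr [- _ + _]addrC.
have := congr1 determinant E.
by rewrite det_mulmx det_ublock det_lblock !det1 !mulr1 det_scalar expr1.
Qed.

(** The block matrix sends the vector [y] below to one with vanishing first block, so the form at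
    [y] is the form of the Schur complement at [x]. Positivity of [a] is the value at the first
    basis vector. *)
Lemma posdef_block {n} (a : R) (v : 'cV[R]_n) (S : 'M[R]_n) :
  posdef (block_mx a%:M v^T v S : 'M[R]_(1 + n)) ->
  0 < a /\ posdef (S - a^-1 *: (v *m v^T)).
Proof.
move=> [Ms Mp].
have a0 : 0 < a.
  have /Mp : col_mx 1%:M 0 != 0 :> 'cV[R]_(1 + n).
    apply/negP => /eqP /matrixP /(_ (lshift n 0) 0).
    by rewrite col_mxEu !mxE eqxx => /eqP; rewrite oner_eq0.
  rewrite /qform tr_col_mx trmx1 trmx0 mul_row_block mul_row_col !mul0mx mulmx0.
  by rewrite !addr0 mul1mx mulmx1 mxE eqxx.
split=> //; split.
  move: Ms; rewrite tr_block_mx => /eq_block_mx [_ _ _ SE].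
  by rewrite linearB /= SE linearZ /= trmx_mul trmxK.
move=> x x0.
pose y : 'cV[R]_(1 + n) := col_mx (- a^-1 *: (v^T *m x)) x.
have /Mp : y != 0.
  apply: contra_neq x0 => /(congr1 dsubmx); rewrite /y col_mxKd => ->.
  by apply/matrixP => i j; rewrite !mxE.
rewrite /qform -mulmxA /y mul_block_col mul_scalar_mx scalerA mulrN divff ?gt_eqF //.
rewrite scaleN1r addNr tr_col_mx mul_row_col mulmx0 add0r -scalemxAr addrC.
by rewrite scaleNr -[x^T *m _ *m x]mulmxA mulmxBl -scalemxAl -(mulmxA v).
Qed.

Lemma posdef_diag_gt0 {n} (M : 'M[R]_n) i : posdef M -> 0 < M i i.
Proof.
move=> [_ /(_ (delta_mx i 0))]; rewrite /qform => H.
have : delta_mx i 0 != 0 :> 'cV[R]_n.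
  by apply/negP => /eqP/matrixP/(_ i 0)/eqP; rewrite !mxE !eqxx oner_eq0.
by move=> /H; rewrite trmx_delta -rowE -colE !mxE.
Qed.

(* Hadamard's inequality, by induction through the Schur complement. *)
Lemma posdef_det {n} (M : 'M[R]_n) :
  posdef M -> 0 < \det M <= \prod_i M i i.
Proof.
elim: n M => [|n IH] M pM; first by rewrite det_mx00 big_ord0 ltr01 lexx.
pose M' : 'M[R]_(1 + n) := M.
pose a := ulsubmx M' 0 0; pose v := dlsubmx M'; pose S := drsubmx M'.
have ME : M' = block_mx a%:M v^T v S.
  rewrite /a -mx11_scalar -[LHS]submxK; congr block_mx.
  by rewrite /v trmx_dlsub; case: pM => ->.
have pM2 : posdef (block_mx a%:M v^T v S : 'M[R]_(1 + n)) by rewrite -ME.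
have [a0 pS] := posdef_block pM2.
have /andP[d0 dle] := IH _ pS.
have -> : \det M = a * \det (S - a^-1 *: (v *m v^T)).
  by rewrite -posdef_det_block ?gt_eqF // -ME.
rewrite mulr_gt0 //= big_ord_recl.
have <- : a = M ord0 ord0 by rewrite /a !mxE; congr (M _ _); exact/val_inj.
rewrite ler_pM2l //.
apply: (le_trans dle); apply: ler_prod => i _.
rewrite ltW ?posdef_diag_gt0 //= !mxE big_ord1 !mxE.
rewrite lerBlDr (_ : M' _ _ = M (lift ord0 i) (lift ord0 i)).
  by rewrite lerDl; apply: mulr_ge0; [rewrite invr_ge0 ltW|rewrite -expr2 sqr_ge0].
by congr (M _ _); exact/val_inj.
Qed.

(* The determinant of [block 1 g^T g M] computed through both Schur complements. *)
Lemma det_sub_outer {n} (M : 'M[R]_n) (g : 'cV[R]_n) : M \in unitmx ->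
  \det (M - g *m g^T) = \det M * (1 - (g^T *m invmx M *m g) 0 0).
Proof.
move=> Mu; have := @posdef_det_block n 1 g M (oner_neq0 _).
rewrite invr1 scale1r mul1r => <-; set c := invmx M *m g.
have E : block_mx 1%:M g^T g M *m block_mx 1%:M 0 (- c) 1%:M
    = block_mx (1 - (g^T *m invmx M *m g) 0 0)%:M g^T 0 M :> 'M[R]_(1 + n).
  rewrite mulmx_block !mulmx1 !mulmx0 !add0r !mulmxN /c (mulmxA M) mulmxV // mul1mx subrr.
  by rewrite [in RHS]raddfB /= -mx11_scalar mulmxA.
have := congr1 determinant E.
rewrite det_mulmx det_ublock det_lblock !det1 !mulr1 => ->.
by rewrite det_scalar expr1 mulrC.
Qed.

Lemma qformD_invmx {n} (M : 'M[R]_n) (g x : 'cV[R]_n) (t : R) :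
  M^T = M -> M \in unitmx ->
  qform M (x + t *: (invmx M *m g))
    = qform M x + 2 * t * (x^T *m g) 0 0 + t ^+ 2 * (g^T *m invmx M *m g) 0 0.
Proof.
move=> MT Mu; set c := invmx M *m g.
have Mc : M *m c = g by rewrite mulmxA mulmxV // mul1mx.
have cM : c^T *m M = g^T by rewrite -[in LHS]MT -trmx_mul Mc.
have cg : c^T *m g = g^T *m invmx M *m g by rewrite trmx_mul trmx_inv MT.
have gx : g^T *m x = x^T *m g.
  by rewrite [RHS]mx11_scalar -tr_scalar_mx -mx11_scalar trmx_mul trmxK.
rewrite /qform; have -> : (x + t *: c)^T = x^T + t *: c^T.
  by apply/matrixP => i j; rewrite !mxE.
rewrite -[(_ + _) *m M *m _]mulmxA mulmxDr -scalemxAr Mc mulmxDl 2!mulmxDr.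
rewrite -!scalemxAl -!scalemxAr !mulmxA cM cg gx.
have E (p : R) (A : 'M[R]_1) : (p *: A) 0 0 = p * A 0 0 by rewrite mxE.
have D (A A' : 'M[R]_1) : (A + A') 0 0 = A 0 0 + A' 0 0 by rewrite mxE.
by rewrite !D !E; ring.
Qed.

(** Completing the square shows the right side to be at least [- h / (2 * b)] with [h = g^T M^-1 g].
    Removing [g *m g^T] from [M] multiplies the determinant by [1 - h], so [- ln (1 - h)], which
    dominates [h], is the increment of the log-determinant. *)
Lemma linear_qform_ge_logdet {n} (N : 'M[R]_n) (g x : 'cV[R]_n) (b : R) :
  posdef N -> 0 < b ->
  - (2 * b)^-1 * (ln (\det (N + g *m g^T)) - ln (\det N))
    <= (x^T *m g) 0 0 + b / 2 * qform (N + g *m g^T) x.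
Proof.
move=> pN b0; set M := N + _.
have pM : posdef M by exact: posdefD_outer.
have /andP[dN _] := posdef_det pN; have /andP[dM _] := posdef_det pM.
have Mu : M \in unitmx by rewrite unitmxE unitfE gt_eqF.
have := @det_sub_outer _ M g Mu; rewrite {1}/M addrK.
set h := (_ *m g) 0 0 => dE.
have h1 : 0 < 1 - h by move: dN; rewrite dE pmulr_rgt0.
have lnE : ln (\det N) = ln (\det M) + ln (1 - h) by rewrite dE lnM ?posrE.
have lnh : ln (1 - h) <= - h by have := ln_le_subr1 h1; lra.
have hQ : 0 <= qform M x + 2 / b * (x^T *m g) 0 0 + h / b ^+ 2.
  have -> : qform M x + 2 / b * (x^T *m g) 0 0 + h / b ^+ 2
      = qform M (x + b^-1 *: (invmx M *m g)).
    by rewrite qformD_invmx //; [rewrite -/h; field; rewrite gt_eqF|case: pM].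
  have [->|/(proj2 pM)/ltW//] := eqVneq (x + b^-1 *: (invmx M *m g)) 0.
  by rewrite /qform mulmx0 mxE.
have b20 : 0 < b / 2 by lra.
have := mulr_ge0 (ltW b20) hQ.
have -> : b / 2 * (qform M x + 2 / b * (x^T *m g) 0 0 + h / b ^+ 2)
   = (x^T *m g) 0 0 + b / 2 * qform M x + (2 * b)^-1 * h by field; lra.
have : 0 <= (2 * b)^-1 * (- h - ln (1 - h)) by rewrite mulr_ge0 ?invr_ge0; lra.
by rewrite lnE; set w := (2 * b)^-1; nra.
Qed.

End PositiveDefinite.

(** * Existence and positivity of the regularized minimizers *)

Section Argmin.
Local Open Scope classical_set_scope.
Context {R : realType} {d : nat}.
Implicit Types (x y : 'rV[R]_d) (G : 'rV[R]_d -> R) (eta : R).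

Definition rbarrier x : R := - \sum_i ln (x 0 i).

Lemma simplex_le1 x i : simplex x -> x 0 i <= 1.
Proof.
move=> [x0 <-]; rewrite (bigD1 i) //= lerDl.
by apply: sumr_ge0 => j _; exact: x0.
Qed.

Lemma barrierE x : (forall i, 0 < x 0 i) -> barrier x = (rbarrier x)%:E.
Proof.
move=> x0; rewrite /barrier /rbarrier -sumrN -sumEFin.
by apply: eq_bigr => i _; rewrite lne_EFin.
Qed.

Lemma barrier_pinfty x i : simplex x -> x 0 i = 0 -> barrier x = +oo%E.
Proof.
move=> xs xi; apply/eqP; rewrite -leye_eq /barrier (bigD1 i) // xi le0_lneNy //.
rewrite -[leLHS]adde0 leeD //; apply: sume_ge0 => j _.
by rewrite oppe_ge0 lne_le0 lee_fin; exact: simplex_le1.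
Qed.

Lemma regularizedE eta G x : (forall i, 0 < x 0 i) ->
  regularized eta G x = (G x + eta^-1 * rbarrier x)%:E.
Proof. by move=> x0; rewrite /regularized barrierE. Qed.

Lemma simplex_interval_compact (e : R) : (0 < d)%N ->
  compact [set x : 'rV[R]_d | (forall i, e <= x 0 i <= 1) /\ \sum_i x 0 i = 1].
Proof.
move=> d0.
have -> : [set x : 'rV[R]_d | (forall i, e <= x 0 i <= 1) /\ \sum_i x 0 i = 1]
  = ([set x : 'rV[R]_d | forall i, `[e, 1] (x ord0 i)]
      `&` [set x : 'rV[R]_d | \sum_i x 0 i = 1%R]).
  apply/seteqP; split => x -[H1 H2]; split=> //= i; have := H1 i;
  by rewrite /= in_itv.
apply: compact_closedI.
  by apply: (@rV_compact _ _ (fun=> `[e, 1])) => i; exact: segment_compact.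
apply: (@preimage_closed _ _ (fun x : 'rV[R]_d => \sum_i x 0 i) [set 1]);
  last exact: closed_eq.
move=> x _; have : continuous (fun x : 'rV[R]_d => \sum_i x 0 i); last exact.
apply: continuous_big => [|i _]; first exact: add_continuous.
exact: coord_continuous.
Qed.

Lemma rbarrier_continuous x : (forall i, 0 < x 0 i) -> {for x, continuous rbarrier}.
Proof.
move=> x0.
have H : (\sum_(i < d) ln (z 0 i)) @[z --> x] --> \sum_(i < d) ln (x 0 i);
  last exact: (cvgN (FF := nbhs_filter x) H).
have addc : continuous (fun z : R * R => z.1 + z.2) by exact: add_continuous.
have := @cvg_big R 'I_d +%R 0 xpredT addc _ (nbhs x) (index_enum _)
  (fun i (z : 'rV[R]_d) => ln (z 0 i)) (fun i => ln (x 0 i)) (nbhs_filter x).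
apply=> i _.
have := @cvg_comp _ _ _ (fun z : 'rV[R]_d => z 0 i) (@ln R) (nbhs x) _ _
  (@coord_continuous R 1 d 0 i x) (continuous_ln (x0 i)).
exact.
Qed.

Definition uniform_pt : 'rV[R]_d := const_mx d%:R^-1.

Lemma uniform_simplex : (0 < d)%N -> simplex uniform_pt.
Proof.
move=> d0; split=> [i|]; first by rewrite mxE invr_ge0.
under eq_bigr do rewrite mxE.
by rewrite sumr_const card_ord -[LHS]mulr_natr mulVf // pnatr_eq0 -lt0n.
Qed.

(** The barrier blows up at the boundary, so it suffices to minimize over a truncated simplex, which
    is compact and on which the objective is finite and continuous. Points outside it do no better
    than the uniform point. *)
Lemma regularized_min_exists eta G : (0 < d)%N -> 0 < eta -> continuous G ->
  exists x, simplex x /\ forall y, simplex y ->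
    (regularized eta G x <= regularized eta G y)%E.
Proof.
move=> d0 eta0 Gc; set H := fun x => G x + eta^-1 * rbarrier x.
have us := uniform_simplex d0.
have up i : 0 < uniform_pt 0 i by rewrite mxE invr_gt0 ltr0n.
have [c cK cmin] : exists2 c : 'rV[R]_d, c \in [set x : 'rV[R]_d |
    (forall i, 0 <= x 0 i <= 1) /\ \sum_i x 0 i = 1] &
    forall t, t \in [set x : 'rV[R]_d |
    (forall i, 0 <= x 0 i <= 1) /\ \sum_i x 0 i = 1] -> G c <= G t.
  apply: EVT_min_rV; last exact: continuous_subspaceT.
    exists uniform_pt; split; last by case: us.
    by move=> i; rewrite ltW //= simplex_le1.
  exact: simplex_interval_compact.
have Gmin y : simplex y -> G c <= G y.
  move=> ys; apply: cmin; rewrite inE; split; last by case: ys.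
  by move=> i; rewrite simplex_le1 // andbT; case: ys.
(* A coordinate below the second term makes the barrier so large that the objective is at least
   [H uniform_pt], even if [G] takes its least value [G c]. The first term keeps [uniform_pt] inside
   the truncated simplex. *)
pose e := Num.min d%:R^-1 (expR (- (eta * (H uniform_pt - G c)))).
have e0 : 0 < e by rewrite lt_min expR_gt0 invr_gt0 ltr0n d0.
have [a aK amin] : exists2 a : 'rV[R]_d, a \in [set x : 'rV[R]_d |
    (forall i, e <= x 0 i <= 1) /\ \sum_i x 0 i = 1] &
    forall t, t \in [set x : 'rV[R]_d |
    (forall i, e <= x 0 i <= 1) /\ \sum_i x 0 i = 1] -> H a <= H t.
  apply: EVT_min_rV; last first.
  - apply: continuous_in_subspaceT => x; rewrite inE => -[xe _].
    have xp i : 0 < x 0 i by rewrite (lt_le_trans e0) //; case/andP: (xe i).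
    have xf := nbhs_filter x.
    exact: (cvgD (Gc x) (cvgM (cvg_cst eta^-1) (rbarrier_continuous xp))).
  - exact: simplex_interval_compact.
  - exists uniform_pt; split; last by case: us.
    by move=> i; rewrite simplex_le1 // andbT mxE ge_min lexx.
move: aK; rewrite inE => -[ae a1].
have ap i : 0 < a 0 i by rewrite (lt_le_trans e0) //; case/andP: (ae i).
have as_ : simplex a by split=> // i; exact/ltW.
have au : H a <= H uniform_pt.
  apply: amin; rewrite inE; split; last by case: us.
  by move=> i; rewrite simplex_le1 // andbT mxE ge_min lexx.
exists a; split => // y ys; rewrite regularizedE //.
have [/forallP yp|] := boolP [forall i, 0 < y 0 i]; last first.
  rewrite negb_forall => /existsP[i]; rewrite -leNgt => yi.
  have yi0 : y 0 i = 0 by apply/eqP; rewrite eq_le yi; case: ys => ->.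
  rewrite /regularized (barrier_pinfty ys yi0) gt0_muley ?lte_fin ?invr_gt0 //.
  by rewrite addey // leey.
rewrite regularizedE // lee_fin -!/(H _).
have [/forallP ye|] := boolP [forall i, e <= y 0 i].
  apply: amin; rewrite inE; split; last by case: ys.
  by move=> i; rewrite ye simplex_le1.
rewrite negb_forall => /existsP[i]; rewrite -ltNge => yi.
apply: (le_trans au).
have lne : ln (y 0 i) <= - (eta * (H uniform_pt - G c)).
  rewrite -[leRHS]expRK ler_ln ?posrE ?expR_gt0 ?yp //.
  by rewrite (le_trans (ltW yi)) // ge_min lexx orbT.
have Ry : - ln (y 0 i) <= rbarrier y.
  rewrite /rbarrier lerN2 (bigD1 i) //= gerDl.
  by apply: sumr_le0 => j _; rewrite ln_le0 ?simplex_le1.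
have : eta * (H uniform_pt - G c) <= rbarrier y by apply: le_trans Ry; rewrite lerNr.
rewrite -ler_pdivlMl // lerBlDl => /le_trans; apply.
by rewrite /H lerD2r Gmin.
Qed.

Lemma argmin_regularized eta G : (0 < d)%N -> 0 < eta -> continuous G ->
  let x := argmin_simplex (regularized eta G) in
  [/\ simplex x, forall i, 0 < x 0 i &
    forall y, simplex y -> (forall i, 0 < y 0 i) ->
      G x + eta^-1 * rbarrier x <= G y + eta^-1 * rbarrier y].
Proof.
move=> d0 eta0 Gc x.
have [xs xmin] : simplex x /\ forall y, simplex y ->
    (regularized eta G x <= regularized eta G y)%E.
  by have /getPex := regularized_min_exists d0 eta0 Gc.
(* A zero coordinate would give the value [+oo], against the finite value at the uniform point. *)
have xp i : 0 < x 0 i.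
  rewrite lt_neqAle eq_sym; case: (xs) => -> _; rewrite andbT.
  apply: contraPN (xmin _ (uniform_simplex d0)) => /eqP xi; apply/negP.
  rewrite -ltNge regularizedE; last by move=> j; rewrite mxE invr_gt0 ltr0n.
  rewrite /regularized (barrier_pinfty xs xi) gt0_muley ?lte_fin ?invr_gt0 //.
  by rewrite addey // ltry.
split=> // y ys yp.
by have := xmin _ ys; rewrite !regularizedE // lee_fin.
Qed.

End Argmin.

(** * Inner products, continuity of the surrogates, and the gradient of the loss *)

Section Dotv.
Context {R : realType} {d : nat}.
Implicit Types x y z g : 'rV[R]_d.

Lemma dotvDl x y g : dotv (x + y) g = dotv x g + dotv y g.
Proof. by rewrite -big_split; apply: eq_bigr => i _; rewrite mxE mulrDl. Qed.

Lemma dotvZl (t : R) x g : dotv (t *: x) g = t * dotv x g.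
Proof. by rewrite /dotv mulr_sumr; apply: eq_bigr => i _; rewrite mxE mulrA. Qed.

Lemma dotvC x g : dotv x g = dotv g x.
Proof. by apply: eq_bigr => i _; rewrite mulrC. Qed.

Lemma dotvZr (t : R) x g : dotv x (t *: g) = t * dotv x g.
Proof. by rewrite dotvC dotvZl dotvC. Qed.

Lemma dotvNl x g : dotv (- x) g = - dotv x g.
Proof. by rewrite -scaleN1r dotvZl mulN1r. Qed.

Lemma dotvBl x y g : dotv (x - y) g = dotv x g - dotv y g.
Proof. by rewrite dotvDl dotvNl. Qed.

Lemma dotvDr x g g' : dotv x (g + g') = dotv x g + dotv x g'.
Proof. by rewrite dotvC dotvDl !(dotvC x). Qed.

Lemma dotvBr x g g' : dotv x (g - g') = dotv x g - dotv x g'.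
Proof. by rewrite dotvC dotvBl !(dotvC x). Qed.

Lemma dotv0r x : dotv x 0 = 0.
Proof. by rewrite -(scale0r 0) dotvZr mul0r. Qed.

Lemma dotv_mulmx x g : dotv x g = (x *m g^T) 0 0.
Proof. by rewrite mxE; apply: eq_bigr => i _; rewrite mxE. Qed.

Lemma dotv_ge0 x g : (forall i, 0 <= x 0 i) -> (forall i, 0 <= g 0 i) -> 0 <= dotv x g.
Proof. by move=> x0 g0; apply: sumr_ge0 => i _; exact: mulr_ge0. Qed.

Lemma dotv_delta i g : dotv (delta_mx 0 i) g = g 0 i.
Proof.
rewrite /dotv (bigD1 i) //= mxE !eqxx mul1r big1 ?addr0 // => j ji.
by rewrite mxE eqxx (negbTE ji) mul0r.
Qed.

Lemma dotv_simplex_gt0 x g : (forall i, 0 < x 0 i) -> simplex g -> 0 < dotv x g.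
Proof.
move=> x0 [g0 g1]; have [i gi] : exists i, 0 < g 0 i.
  apply/existsP; apply: contraPT g1; rewrite negb_exists => /forallP H.
  rewrite big1 => [/eqP|i _]; first by rewrite eq_sym oner_eq0.
  by apply/eqP; rewrite eq_le g0 andbT leNgt H.
rewrite /dotv (bigD1 i) //= ltr_pwDl ?mulr_gt0 //.
by apply: sumr_ge0 => j _; apply: mulr_ge0; [exact: ltW|].
Qed.

Lemma dotv_continuous g : continuous (fun x => dotv x g).
Proof.
rewrite /dotv; apply: continuous_big => [|i _]; first exact: add_continuous.
by move=> x; exact: (cvgM (@coord_continuous R 1 d 0 i x) (cvg_cst (g 0 i))).
Qed.

Lemma fhat_continuous (b : R) (f : 'rV[R]_d -> R) xt : continuous (fhat b f xt).
Proof.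
move=> x; rewrite /continuous_at /fhat.
set g := gradient f xt.
have zc : (dotv (y - xt) g @[y --> x] --> dotv (x - xt) g)%classic.
  have -> : (fun y => dotv (y - xt) g) = (fun y => dotv y g - dotv xt g).
    by apply/funext => y; rewrite dotvBl.
  rewrite dotvBl.
  by exact: (cvgB (@dotv_continuous g x) (cvg_cst _)).
exact: (cvgD (cvgD (cvg_cst _) zc) (cvgM (cvg_cst _) (cvgM zc zc))).
Qed.

Lemma loss_gradient r x : 0 < dotv x r ->
  gradient (loss r) x = - (dotv x r)^-1 *: r.
Proof.
move=> xr; apply/rowP => i; rewrite !mxE.
pose phi (h : R) := - ln (dotv x r + h * r 0 i).
(* Both derivatives are limits of the same difference quotient, which reduces the partial derivative
   to one real variable. *)
have -> : derive (loss r) x (delta_mx 0 i) = derive phi (0 : R) (1 : R).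
  have E : (fun h : R => h^-1 *: ((loss r \o shift x) (h *: delta_mx 0 i) - loss r x))
      = (fun h : R => h^-1 *: ((phi \o shift 0) (h *: 1) - phi 0)).
    apply/funext => h /=; rewrite /phi /loss /= dotvDl dotvZl dotv_delta.
    by rewrite mul0r !addr0 [h%:A]mulr1 [_ + dotv x r]addrC.
  by rewrite /derive E.
suff : is_derive (0 : R) (1 : R) phi (- (dotv x r)^-1 * r 0 i) by move=> [].
have lin : is_derive (0 : R) 1 (fun h : R => dotv x r + h * r 0 i) (r 0 i).
  have := is_deriveD (is_derive_cst (dotv x r) (0 : R) (1 : R))
    (is_deriveM (is_derive_id (0 : R) (1 : R)) (is_derive_cst (r 0 i) (0 : R) (1 : R))).
  by rewrite scaler0 !add0r [_ *: 1]mulr1.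
have lnd : is_derive (dotv x r + 0 * r 0 i) 1 (@ln R) (dotv x r)^-1.
  by rewrite mul0r addr0; exact: is_derive1_ln.
have := is_deriveN
  (@is_derive1_comp R (@ln R) (fun h : R => dotv x r + h * r 0 i) 0 _ _ lnd lin).
by rewrite mulNr.
Qed.

End Dotv.

(** * Optimality conditions and the Bregman divergence of the barrier *)

Section FirstOrder.
Context {R : realType} {d : nat}.
Implicit Types (x y : 'rV[R]_d) (G : 'rV[R]_d -> R).

(** The Bregman divergence of [rbarrier], also known as the Itakura-Saito distance; the terms
    [y 0 i / x 0 i - 1] come from the linearization at [x]. *)
Definition bregman y x : R := \sum_i (y 0 i / x 0 i - 1 - ln (y 0 i / x 0 i)).

Lemma bregman_term_ge0 (q : R) : 0 < q -> 0 <= q - 1 - ln q.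
Proof. by move=> /ln_le_subr1; rewrite subr_ge0. Qed.

Lemma bregman_ge_term y x i : (forall i, 0 < y 0 i) -> (forall i, 0 < x 0 i) ->
  y 0 i / x 0 i - 1 - ln (y 0 i / x 0 i) <= bregman y x.
Proof.
move=> y0 x0; rewrite /bregman (bigD1 i) //= lerDl; apply: sumr_ge0 => j _.
by rewrite bregman_term_ge0 // divr_gt0.
Qed.

Lemma bregman_ge0 y x : (forall i, 0 < y 0 i) -> (forall i, 0 < x 0 i) ->
  0 <= bregman y x.
Proof.
by move=> y0 x0; apply: sumr_ge0 => i _; rewrite bregman_term_ge0 // divr_gt0.
Qed.

Definition minimizes (eta : R) G x := [/\ simplex x, forall i, 0 < x 0 i &
    forall y, simplex y -> (forall i, 0 < y 0 i) ->
      G x + eta^-1 * rbarrier x <= G y + eta^-1 * rbarrier y].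

Lemma argmin_barrier_minimizes eta : (0 < d)%N -> 0 < eta ->
  minimizes eta (fun=> 0) (argmin_simplex (@barrier R d)).
Proof.
move=> d0 eta0; set x := argmin_simplex _.
have -> : x = argmin_simplex (regularized 1 (fun=> 0 : R)).
  rewrite /x; congr argmin_simplex; apply/funext => y.
  by rewrite /regularized add0e invr1 mul1e.
have c0 : continuous (fun _ : 'rV[R]_d => 0 : R) by exact: cst_continuous.
have [xs xp xmin] := argmin_regularized d0 ltr01 c0; split=> // y ys yp.
by have := xmin y ys yp; rewrite !add0r invr1 !mul1r ler_pM2l ?invr_gt0.
Qed.

(** All cumulative objectives are quadratic, so their Taylor expansion along a segment is exact: [a]
    is the directional derivative at [x] and [q] half the second derivative. This replaces
    differentiation of [G]. *)
Definition quadratic_along G x y (a q : R) :=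
  forall t : R, G (x + t *: (y - x)) = G x + t * a + t ^+ 2 * q.

(** Stands in for the limit [t -> 0] in the first-order condition. If [A] were negative, the point
    [e] below would keep [e * K] at most [- A / 2] and the sum negative. *)
Lemma ge0_of_small_linear (A K : R) :
  (forall t, 0 < t -> t <= 1 / 2 -> 0 <= A + t * K) -> 0 <= A.
Proof.
move=> H; rewrite leNgt; apply/negP => A0.
pose e := Num.min (1 / 2) (- A / (2 * (`|K| + 1))).
have K1 : 0 < `|K| + 1 by rewrite ltr_wpDl.
have e0 : 0 < e.
  by rewrite lt_min; apply/andP; split; [lra|apply: divr_gt0; lra].
have e1 : e <= 1 / 2 by rewrite ge_min lexx.
have e2 : e * (`|K| + 1) <= - A / 2.
  rewrite -ler_pdivlMr //; apply: (@le_trans _ _ (- A / (2 * (`|K| + 1)))).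
    by rewrite ge_min lexx orbT.
  by rewrite invfM mulrA.
have := H e e0 e1; have := ler_norm K; nra.
Qed.

Lemma ln1D_ge (w : R) : - (1 / 2) <= w -> w - 2 * w ^+ 2 <= ln (1 + w).
Proof.
move=> w0; have w1 : 0 < 1 + w by lra.
apply: le_trans (ln_ge_subV w1).
have -> : 1 - (1 + w)^-1 = w / (1 + w) by field; lra.
rewrite ler_pdivlMr //.
suff : 0 <= w ^+ 2 * (1 + 2 * w) by lra.
by rewrite mulr_ge0 ?sqr_ge0 //; lra.
Qed.

Lemma segment_simplex x y (t : R) : 0 < t -> t <= 1 / 2 ->
  simplex x -> (forall i, 0 < x 0 i) -> simplex y ->
  simplex (x + t *: (y - x)) /\ forall i, 0 < (x + t *: (y - x)) 0 i.
Proof.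
move=> t0 t1 [_ x1] xp [y0 y1].
have zp i : 0 < (x + t *: (y - x)) 0 i.
  by rewrite !mxE; have := xp i; have := y0 i; nra.
split=> //; split=> [i|]; first exact: ltW.
under eq_bigr do rewrite !mxE.
by rewrite big_split /= -mulr_sumr big_split /= sumrN x1 y1 subrr mulr0 addr0.
Qed.

(** Moving from [x] by [t] towards [y] changes the barrier by the sum of the [- ln (1 + t * c i)],
    which is linear in [t] up to order [t ^+ 2]; divide by [t] and let it shrink. The target [y] may
    lie on the boundary, which later allows the vertices. *)
Lemma minimizes_first_order eta G x y a q : 0 < eta -> minimizes eta G x ->
  simplex y -> quadratic_along G x y a q ->
  eta^-1 * \sum_i (y 0 i / x 0 i - 1) <= a.
Proof.
move=> eta0 [xs xp xmin] ys Gq; rewrite -subr_ge0.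
pose c i := y 0 i / x 0 i - 1.
apply: (@ge0_of_small_linear _ (q + eta^-1 * (2 * \sum_i c i ^+ 2))) => t t0 t1.
have [zs zp] := segment_simplex t0 t1 xs xp ys.
have cN1 i : -1 <= c i by rewrite /c; have := divr_ge0 (ys.1 i) (ltW (xp i)); lra.
have zE i : (x + t *: (y - x)) 0 i = x 0 i * (1 + t * c i).
  by rewrite !mxE /c; field; rewrite gt_eqF.
have := xmin _ zs zp; rewrite Gq -subr_ge0.
have -> : rbarrier (x + t *: (y - x)) = rbarrier x - \sum_i ln (1 + t * c i).
  rewrite /rbarrier -opprD -big_split /=; congr (- _); apply: eq_bigr => i _.
  rewrite zE lnM // posrE //; have := zp i; rewrite zE pmulr_rgt0 //.
move=> H; rewrite -(pmulr_rge0 _ t0).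
have S : \sum_i (t * c i - t ^+ 2 * (2 * c i ^+ 2)) <= \sum_i ln (1 + t * c i).
  apply: ler_sum => i _; have := @ln1D_ge (t * c i); rewrite exprMn.
  by have := cN1 i => h1 h2; apply: le_trans (h2 _); [lra|nra].
move: S; rewrite sumrB -!mulr_sumr => S.
have eta1 : 0 < eta^-1 by rewrite invr_gt0.
by move: H S; set S1 := \sum_i c i; set S2 := \sum_i c i ^+ 2;
  set S3 := \sum_i ln _; set rb := rbarrier x; nra.
Qed.

Lemma rbarrier_bregman x y : (forall i, 0 < y 0 i) -> (forall i, 0 < x 0 i) ->
  rbarrier y = rbarrier x - \sum_i (y 0 i / x 0 i - 1) + bregman y x.
Proof.
move=> y0 x0; rewrite /rbarrier.
have -> : bregman y x = \sum_i (y 0 i / x 0 i - 1) - \sum_i ln (y 0 i / x 0 i).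
  by rewrite /bregman sumrB.
have -> : \sum_i ln (y 0 i) = \sum_i ln (x 0 i) + \sum_i ln (y 0 i / x 0 i).
  rewrite -big_split; apply: eq_bigr => i _ /=.
  by rewrite -lnM ?posrE ?divr_gt0 // mulrC divfK ?gt_eqF.
by set A := \sum_i (_ / _ - 1); lra.
Qed.

(** Beyond the first-order terms, which optimality makes nonnegative in total, the objective at [y]
    exceeds that at [x] by the curvature [q] of [G] and the divergence of the barrier. *)
Lemma minimizes_bregman eta G x y a q : 0 < eta -> minimizes eta G x ->
  simplex y -> (forall i, 0 < y 0 i) -> quadratic_along G x y a q ->
  G x + eta^-1 * rbarrier x + q + eta^-1 * bregman y x <= G y + eta^-1 * rbarrier y.
Proof.
move=> eta0 xm ys yp Gq; have := minimizes_first_order eta0 xm ys Gq.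
case: xm => _ xp _; rewrite (rbarrier_bregman yp xp).
have := Gq 1; rewrite scale1r addrC subrK => ->; lra.
Qed.

End FirstOrder.

(** * Scalar inequalities for the surrogate, the bias and the divergence *)

(** The left side is the tangent at [z] of the surrogate [z + b / 2 * z ^+ 2], taken at [w]. Its
    slope is [c = 1 + b * z], so the logarithm is compared with its own tangent of slope [c],
    through [ln (c * (1 - w)) <= c * (1 - w) - 1]; what is left is a bound on [ln c], where
    [c >= 1 / 4] gives [b <= c / 2]. *)
Lemma tangent_le_neg_ln {R : realType} (b z w : R) :
  0 < b -> b <= 1 / 8 -> z <= 1 -> - (3 / 4) <= b * z -> w < 1 ->
  z + b / 2 * z ^+ 2 + (1 + b * z) * (w - z) <= - ln (1 - w).
Proof.
move=> b0 b1 z1 bz w1; set c := 1 + b * z.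
have c0 : 1 / 4 <= c by rewrite /c; lra.
have c1 : 0 < c by lra.
have w0 : 0 < 1 - w by lra.
have := @ln_le_subr1 R (c * (1 - w)); rewrite lnM ?posrE // mulr_gt0 // => /(_ isT).
have := ln_ge_subV c1 => h1 h2.
suff : z + b / 2 * z ^+ 2 + c * (w - z) <= 2 - c^-1 - c * (1 - w) by lra.
have hc : c^-1 = 1 - b * z + (b * z) ^+ 2 / c by rewrite /c; field; rewrite -/c gt_eqF.
have h3 : (b * z) ^+ 2 / c <= b * z ^+ 2 / 2.
  rewrite ler_pdivrMr //.
  have : 0 <= b * z ^+ 2 * (c / 2 - b).
    by apply: mulr_ge0; [apply: mulr_ge0; [exact: ltW|exact: sqr_ge0]|lra].
  by lra.
by rewrite hc; rewrite /c in h3 *; nra.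
Qed.

(** If [x^-1] becomes the new maximum, the increase of the logarithm plus one divergence term equals
    [y / x - 1 - ln (p * y)], and [ln (p * y) <= p * y - 1]. *)
Lemma bias_term_le {R : realType} (x y p : R) : 0 < x -> 0 < y -> 0 < p ->
  y * (Num.max p x^-1 - p) <= 2 * (y / x - 1 - ln (y / x)) + (ln (Num.max p x^-1) - ln p).
Proof.
move=> x0 y0 p0; have q0 : 0 < y / x by rewrite divr_gt0.
have := bregman_term_ge0 q0; have [px|px] := leP x^-1 p => h.
  by rewrite !subrr mulr0 addr0; lra.
have := @ln_le_subr1 R (p * y); rewrite lnM ?posrE // mulr_gt0 // => /(_ isT).
have := ln_le_subr1 q0; rewrite ln_div ?posrE // lnV ?posrE // => h1 h2; lra.
Qed.

(** With [t] the square root of [y / x], the right side is at least [(t - 1) ^+ 2], and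
    [y - x = x * (t - 1) * (t + 1)] where [x * (t + 1) <= 2]. *)
Lemma bregman_term_ge_sqr {R : realType} (x y : R) :
  0 < x -> 0 < y -> x <= 1 -> y <= 1 ->
  (y - x) ^+ 2 / 4 <= y / x - 1 - ln (y / x).
Proof.
move=> x0 y0 x1 y1; set q := y / x; have q0 : 0 < q by rewrite divr_gt0.
pose t := Num.sqrt q; have t0 : 0 < t by rewrite sqrtr_gt0.
have tq : q = t ^+ 2 by rewrite sqr_sqrtr // ltW.
have yE : y = x * t ^+ 2 by rewrite -tq /q mulrC divfK // gt_eqF.
have lnq : ln q <= 2 * (t - 1).
  by rewrite tq expr2 lnM ?posrE //; have := ln_le_subr1 t0; lra.
suff : (y - x) ^+ 2 / 4 <= (t - 1) ^+ 2 by rewrite tq in lnq *; lra.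
have -> : (y - x) ^+ 2 / 4 = (t - 1) ^+ 2 * (x ^+ 2 * (t + 1) ^+ 2 / 4).
  by rewrite yE; field.
rewrite ler_piMr ?sqr_ge0 //.
have : 0 <= x ^+ 2 * (t - 1) ^+ 2 by rewrite mulr_ge0 ?sqr_ge0.
have : x ^+ 2 * t ^+ 2 <= x by rewrite (_ : _ * _ = x * y) ?yE; [rewrite -yE; nra|ring].
have : x ^+ 2 <= x by nra.
lra.
Qed.

(** * A single epoch: iterates, surrogates and the vector p *)

Section EpochSequence.
Context {R : realType} {d : nat}.
Variables (B eta beta : R) (r : nat -> 'rV[R]_d).
Implicit Types (n m : nat) (x y : 'rV[R]_d).
Hypothesis d_gt0 : (0 < d)%N.
Hypothesis B_ge : 20 * d%:R <= B.
Hypothesis etaE : eta = 1 / (4 * B).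
Hypothesis betaE : beta = 11 / (7 * B).

(** The algorithm inside one epoch, with the reset test left out. Indices start at 0:
    [epoch_state n] and [r n] belong to internal time [n.+1]. *)
Fixpoint epoch_state (n : nat) : state R d :=
  if n is m.+1 then advance B eta beta (loss (r m)) (epoch_state m)
  else epoch_init R d.

Let X n := xcur (epoch_state n).
Let U n := ucur (epoch_state n).
Let P n := pcur (epoch_state n).
Let Pold n := pold (epoch_state n).
Let F n := cumf (epoch_state n).
Let G n := cumg (epoch_state n).
Let g n := gradient (loss (r n)) (X n).
Let fh n := fhat beta (loss (r n)) (X n).
(** By [z_ratio], [1 - z n y] is the ratio of the returns of [y] and of the played point. Up to the
    constant [loss (r n) (X n)], the true loss is thus [- ln (1 - z)] and the surrogate
    [z + beta / 2 * z ^+ 2]. *)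
Let z n (y : 'rV[R]_d) := dotv (y - X n) (g n).

Lemma d_ge1 : (1 : R) <= d%:R.
Proof. by rewrite ler1n. Qed.

Lemma B_ge20 : 20 <= B.
Proof. by have := d_ge1; have := B_ge; lra. Qed.

Lemma B_gt0 : 0 < B.
Proof. by have := B_ge20; lra. Qed.

Lemma eta_gt0 : 0 < eta.
Proof. by rewrite etaE divr_gt0 // mulr_gt0 // B_gt0. Qed.

Lemma etaV : eta^-1 = 4 * B.
Proof. by rewrite etaE mul1r invrK. Qed.

Lemma beta_gt0 : 0 < beta.
Proof. by rewrite betaE divr_gt0 // mulr_gt0 // B_gt0. Qed.

Lemma betaV : beta^-1 = 7 * B / 11.
Proof. by rewrite betaE invfM invrK mulrC. Qed.

Lemma beta_le : beta <= 11 / 140.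
Proof.
rewrite betaE ler_pdivrMr; have := B_ge20; last by lra.
by lra.
Qed.

Lemma betaB : beta * B = 11 / 7.
Proof. by rewrite betaE; field; rewrite gt_eqF // B_gt0. Qed.

Lemma F_sum n y : F n y = \sum_(s < n) fh s y.
Proof.
elim: n => [|n IH]; first by rewrite big_ord0.
by rewrite big_ord_recr /= -IH.
Qed.

Lemma G_sum n y : G n y = F n y - B * dotv y (Pold n - Pold 0).
Proof.
elim: n => [|n IH]; first by rewrite subrr dotv0r mulr0 subr0.
have -> : G n.+1 y = G n y + (fh n y - B * dotv y (P n - Pold n)) by [].
have -> : F n.+1 y = F n y + fh n y by [].
have -> : Pold n.+1 - Pold 0 = (P n - Pold n) + (Pold n - Pold 0).
  by rewrite addrA subrK.
by rewrite IH [in RHS]dotvDr; ring.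
Qed.

Lemma F_continuous n : continuous (F n).
Proof.
elim: n => [|n IH]; first exact: cst_continuous.
by move=> y; exact: (cvgD (IH y) (@fhat_continuous _ _ beta (loss (r n)) (X n) y)).
Qed.

Lemma G_continuous n : continuous (G n).
Proof.
elim: n => [|n IH]; first exact: cst_continuous.
move=> y; have fc := @fhat_continuous _ _ beta (loss (r n)) (X n) y.
exact: (cvgD (IH y) (cvgB fc (cvgM (cvg_cst B) (@dotv_continuous _ _ (P n - Pold n) y)))).
Qed.

Lemma U_minimizes n : minimizes eta (F n) (U n).
Proof.
case: n => [|n]; first exact: argmin_barrier_minimizes d_gt0 eta_gt0.
exact: (argmin_regularized d_gt0 eta_gt0 (@F_continuous n.+1)).
Qed.

Lemma X_minimizes n : minimizes eta (G n) (X n).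
Proof.
case: n => [|n]; first exact: argmin_barrier_minimizes d_gt0 eta_gt0.
exact: (argmin_regularized d_gt0 eta_gt0 (@G_continuous n.+1)).
Qed.

Lemma X_simplex n : simplex (X n). Proof. by case: (X_minimizes n). Qed.
Lemma U_simplex n : simplex (U n). Proof. by case: (U_minimizes n). Qed.
Lemma X_gt0 n i : 0 < X n 0 i. Proof. by case: (X_minimizes n). Qed.
Lemma U_gt0 n i : 0 < U n 0 i. Proof. by case: (U_minimizes n). Qed.

Lemma P_pmax n : P n = pmax (Pold n) (X n).
Proof. by case: n. Qed.

Lemma PE n i : P n 0 i = Num.max (Pold n 0 i) (X n 0 i)^-1.
Proof. by rewrite P_pmax mxE. Qed.

Lemma P_geV n i : (X n 0 i)^-1 <= P n 0 i.
Proof. by rewrite PE le_max lexx orbT. Qed.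

Lemma P_leS n i : P n 0 i <= P n.+1 0 i.
Proof. by rewrite [leRHS]PE le_max lexx. Qed.

Lemma P_mono m n i : (m <= n)%N -> P m 0 i <= P n 0 i.
Proof.
move=> /subnK <-; elim: (n - m)%N => [|k IH]; first by rewrite add0n.
by rewrite addSn; exact: le_trans (P_leS _ _).
Qed.

Lemma P_ge n i : d%:R <= P n 0 i.
Proof.
by apply: le_trans (@P_mono 0 n i _); rewrite // PE le_max mxE lexx.
Qed.

Lemma P_gt0 n i : 0 < P n 0 i.
Proof. by apply: lt_le_trans (P_ge _ _); rewrite ltr0n. Qed.

Lemma quadratic_fh n x y :
  quadratic_along (fh n) x y ((1 + beta * z n x) * dotv (y - x) (g n))
    (beta / 2 * dotv (y - x) (g n) ^+ 2).
Proof.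
move=> t; rewrite /fh /fhat -/(g n) /z.
have -> : dotv (x + t *: (y - x) - X n) (g n) = dotv (x - X n) (g n) + t * dotv (y - x) (g n).
  by rewrite addrAC [LHS]dotvDl dotvZl.
by field.
Qed.

Lemma quadratic_F n x y :
  quadratic_along (F n) x y
    (\sum_(s < n) (1 + beta * z s x) * dotv (y - x) (g s))
    (beta / 2 * \sum_(s < n) dotv (y - x) (g s) ^+ 2).
Proof.
move=> t; rewrite !F_sum !mulr_sumr -!big_split /=; apply: eq_bigr => s _.
exact: quadratic_fh.
Qed.

Lemma quadratic_G n x y :
  quadratic_along (G n) x y
    (\sum_(s < n) (1 + beta * z s x) * dotv (y - x) (g s)
       - B * dotv (y - x) (Pold n - Pold 0))
    (beta / 2 * \sum_(s < n) dotv (y - x) (g s) ^+ 2).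
Proof.
move=> t; rewrite !G_sum quadratic_F; set D := Pold n - Pold 0.
have -> : dotv (x + t *: (y - x)) D = dotv x D + t * dotv (y - x) D.
  by rewrite [LHS]dotvDl dotvZl.
by ring.
Qed.

(** * Stability of the iterates u in the absence of a reset *)

Variable N : nat.
Hypothesis r_simplex : forall n, (n < N)%N -> simplex (r n).

Lemma Xr_gt0 n : (n < N)%N -> 0 < dotv (X n) (r n).
Proof. by move=> /r_simplex; apply: dotv_simplex_gt0 => i; exact: X_gt0. Qed.

Lemma gE n : (n < N)%N -> g n = - (dotv (X n) (r n))^-1 *: r n.
Proof. by move=> nN; rewrite /g loss_gradient // Xr_gt0. Qed.

Lemma z_ratio n y : (n < N)%N -> z n y = 1 - dotv y (r n) / dotv (X n) (r n).
Proof.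
move=> nN; rewrite /z gE // dotvZr dotvBl.
by have := Xr_gt0 nN => xr; field; rewrite gt_eqF.
Qed.

Lemma z_le1 n y : (n < N)%N -> (forall i, 0 <= y 0 i) -> z n y <= 1.
Proof.
move=> nN y0; rewrite z_ratio // gerBl divr_ge0 ?(ltW (Xr_gt0 nN)) //.
by apply: dotv_ge0 => // i; case: (r_simplex nN).
Qed.

Lemma z_ge n y c : (n < N)%N -> (forall i, y 0 i <= c * X n 0 i) -> 1 - c <= z n y.
Proof.
move=> nN yc; rewrite z_ratio // lerD2l lerN2 ler_pdivrMr ?Xr_gt0 //.
rewrite /dotv mulr_sumr; apply: ler_sum => i _; rewrite mulrA.
by apply: ler_wpM2r => //; case: (r_simplex nN).
Qed.

Lemma loss_z n y : (n < N)%N -> (forall i, 0 < y 0 i) ->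
  loss (r n) y = loss (r n) (X n) - ln (1 - z n y).
Proof.
move=> nN y0; have rs := r_simplex nN; have yr := dotv_simplex_gt0 y0 rs.
rewrite z_ratio // /loss opprB addrCA subrr addr0 ln_div ?posrE ?Xr_gt0 //.
by ring.
Qed.

Lemma fhE n y : fh n y = loss (r n) (X n) + z n y + beta / 2 * z n y ^+ 2.
Proof. by []. Qed.

Let nonreset n := ~~ reset_cond eta beta (epoch_state n).

Lemma nonresetP n i : nonreset n -> U n 0 i * P n 0 i <= (2 * beta)^-1.
Proof.
move=> /existsPn/(_ i); rewrite -ltNge => H.
have e0 := eta_gt0; have b0 := beta_gt0; have u0 := U_gt0 n i; have p0 := P_gt0 n i.
rewrite -[leRHS]mulr1 ler_pdivlMl ?mulr_gt0 // mulrA -ler_pdivlMr // mul1r.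
apply: le_trans (ltW H); rewrite -/(U n) ler_pM2r // ler_pM2r // ler_peMr //; lra.
Qed.

(** The purpose of p: it dominates [(X m)^-1] for all past [m], so one bound against [P n] compares
    [y] with every past iterate. *)
Lemma X_ratio m n y i c : (m <= n)%N -> 0 <= y 0 i ->
  y 0 i * P n 0 i <= c -> y 0 i <= c * X m 0 i.
Proof.
move=> mn y0 yc; rewrite -ler_pdivrMr ?X_gt0 //; apply: le_trans yc.
by rewrite ler_wpM2l // (le_trans (P_geV m i)) // P_mono.
Qed.

(** Adding the optimality gaps of two consecutive iterates bounds the symmetrized divergence by the
    variation of the one new surrogate. *)
Lemma stability n i : (n < N)%N -> nonreset n -> U n.+1 0 i <= 3 / 2 * U n 0 i.
Proof.
move=> nN nr; have b0 := beta_gt0; have b1 := beta_le.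
set x := U n; set y := U n.+1.
have H1 := minimizes_bregman eta_gt0 (U_minimizes n) (U_simplex n.+1)
  (U_gt0 n.+1) (quadratic_F n (U n) (U n.+1)).
have H2 := minimizes_bregman eta_gt0 (U_minimizes n.+1) (U_simplex n)
  (U_gt0 n) (quadratic_F n.+1 (U n.+1) (U n)).
move: H1 H2; rewrite etaV -/x -/y.
rewrite (_ : F n.+1 = (fun w => F n w + fh n w)) //.
set q1 := beta / 2 * _; set q2 := beta / 2 * _.
have q10 : 0 <= q1.
  by rewrite mulr_ge0 ?sumr_ge0 // => [|s _]; rewrite ?sqr_ge0; lra.
have q20 : 0 <= q2.
  by rewrite mulr_ge0 ?sumr_ge0 // => [|s _]; rewrite ?sqr_ge0; lra.
move=> H1 H2.
have zx1 : z n x <= 1 by apply: z_le1 => // j; exact/ltW/U_gt0.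
have zx2 : 1 - (2 * beta)^-1 <= z n x.
  apply: z_ge => // j; apply: (@X_ratio n n) => //; first exact/ltW/U_gt0.
  exact: nonresetP.
have hb : beta * (2 * beta)^-1 = 1 / 2 by field; rewrite gt_eqF.
(* With [v = beta * z], [beta] times the surrogate is [((1 + v) ^+ 2 - 1) / 2] up to a constant. At
   [x], [v] lies between [beta - 1 / 2] and [beta]; at [y] the square is dropped. *)
have gap : beta * (fh n x - fh n y) <= (1 + beta) ^+ 2 / 2.
  rewrite !fhE; have : 0 <= (1 + beta * z n y) ^+ 2 by exact: sqr_ge0.
  have : beta * z n x <= beta by rewrite -[leRHS]mulr1 ler_pM2l.
  have : beta - 1 / 2 <= beta * z n x by rewrite -hb -{1}[beta]mulr1 -mulrBr ler_pM2l.
  set bx := beta * z n x; set by_ := beta * z n y => h1 h2 h3.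
  have -> : beta * (loss (r n) (X n) + z n x + beta / 2 * z n x ^+ 2 -
    (loss (r n) (X n) + z n y + beta / 2 * z n y ^+ 2))
    = bx + bx ^+ 2 / 2 - (by_ + by_ ^+ 2 / 2) by rewrite /bx /by_; field.
  by nra.
have D1 := bregman_ge_term i (U_gt0 n.+1) (U_gt0 n).
have D2 := bregman_ge_term i (U_gt0 n) (U_gt0 n.+1).
move: D1 D2; rewrite -/x -/y => D1 D2.
have x0 : 0 < x 0 i := U_gt0 n i; have y0 : 0 < y 0 i := U_gt0 n.+1 i.
have lnE : ln (x 0 i / y 0 i) = - ln (y 0 i / x 0 i).
  by rewrite -lnV ?posrE ?divr_gt0 // invf_div.
rewrite -ler_pdivrMr //; rewrite lnE -[x 0 i / y 0 i]invf_div in D2.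
set q := y 0 i / x 0 i in D1 D2 *; have q0 : 0 < q by rewrite divr_gt0.
(* In the symmetrized divergence the logarithms cancel and coordinate [i] contributes
   [q + q^-1 - 2], which equals [1 / 6] at [q = 3 / 2]. *)
have key : q + q^-1 - 2 <= 1 / 6.
  have : 4 * B * (bregman y x + bregman x y) <= fh n x - fh n y by lra.
  rewrite -(ler_pM2l b0) => /le_trans /(_ gap).
  have -> : beta * (4 * B * (bregman y x + bregman x y))
     = 44 / 7 * (bregman y x + bregman x y).
    transitivity (4 * (beta * B) * (bregman y x + bregman x y)); first by ring.
    by rewrite betaB; field.
  move=> h; have h2 : (1 + beta) ^+ 2 <= 6 / 5 by nra.
  by lra.
rewrite leNgt; apply/negP => q32.
have : q * (q + q^-1 - 2) <= q * (1 / 6) by rewrite ler_pM2l.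
have -> : q * (q + q^-1 - 2) = q ^+ 2 + 1 - 2 * q by field; rewrite gt_eqF.
by nra.
Qed.

(** Only state [n] has to pass the reset test, so the bound also covers the iterate at which a reset
    is triggered. *)
Lemma U_P_next n i : (n < N)%N -> nonreset n ->
  U n.+1 0 i * P n 0 i <= 3 / (4 * beta).
Proof.
move=> nN nr; have := nonresetP i nr; have := stability i nN nr.
have p0 := P_gt0 n i; have b0 := beta_gt0 => h1 h2.
apply: (@le_trans _ _ (3 / 2 * (U n 0 i * P n 0 i))).
  by rewrite mulrA ler_pM2r.
apply: (@le_trans _ _ (3 / 2 * (2 * beta)^-1)); first by lra.
by rewrite le_eqVlt; apply/orP; left; apply/eqP; field; rewrite gt_eqF.
Qed.

(** The algorithm does not test a fresh state, but the assumption on non-reset states below includes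
    index 0. It holds because [U 0 0 i * P 0 0 i <= d] and [B] is at least [20 * d]. *)
Lemma epoch_init_nonreset : nonreset 0.
Proof.
apply/existsPn => i; rewrite -ltNge -/(U 0) -/(P 0).
have p0 := P_gt0 0 i; have x0 := X_gt0 0 i; have B0 := B_gt0; have d1 := d_ge1.
rewrite -[ltRHS]mul1r ltr_pdivlMr // -(mulrA _ (U 0 0 i)).
have xP : U 0 0 i * P 0 0 i <= d%:R.
  rewrite PE [Pold 0 0 i]mxE; have [_|_] := leP d%:R (X 0 0 i)^-1.
    by rewrite mulfV ?gt_eqF.
  by rewrite ler_piMl ?ler0n // simplex_le1 //; exact: U_simplex.
have c0 : 0 < 2 * (1 + 6 * eta) * beta.
  by rewrite !mulr_gt0 ?beta_gt0 //; have := eta_gt0; lra.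
apply: (le_lt_trans (ler_wpM2l (ltW c0) xP)).
have -> : 2 * (1 + 6 * eta) * beta * d%:R = (22 / 7 * B + 33 / 7) * d%:R / B ^+ 2.
  by rewrite etaE betaE; field; rewrite gt_eqF.
rewrite ltr_pdivrMr ?exprn_gt0 // mul1r.
have : (22 / 7 * B + 33 / 7) * (20 * d%:R) <= (22 / 7 * B + 33 / 7) * B.
  by rewrite ler_pM2l //; lra.
by have := B_ge20; nra.
Qed.

(** * The comparator side: tangents, and a polynomial bound on p *)

Hypothesis nr : forall n, (n < N)%N -> nonreset n.

Lemma z_U_ge s n : (s < n <= N)%N -> - (3 / 4) <= beta * z s (U n).
Proof.
case: n => [|n]; first by rewrite ltn0.
rewrite ltnS => /andP[sn nN]; have b0 := beta_gt0.
have : 1 - 3 / (4 * beta) <= z s (U n.+1).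
  apply: z_ge; first exact: leq_ltn_trans nN.
  move=> i; apply: (X_ratio sn); first exact/ltW/U_gt0.
  by apply: U_P_next => //; exact: nr.
rewrite -(ler_pM2l b0); apply: le_trans.
have -> : beta * (1 - 3 / (4 * beta)) = beta - 3 / 4 by field; rewrite gt_eqF.
by lra.
Qed.

Lemma zB s x y : dotv (y - x) (g s) = z s y - z s x.
Proof. by rewrite /z !dotvBl; ring. Qed.

Lemma loss_ge_tangent s n y : (s < n <= N)%N -> (forall i, 0 < y 0 i) ->
  fh s (U n) + (1 + beta * z s (U n)) * dotv (y - U n) (g s) <= loss (r s) y.
Proof.
move=> sn y0; have sN : (s < N)%N by case/andP: sn => /leq_trans; apply.
have zy : z s y < 1.
  rewrite z_ratio // gtrBl divr_gt0 ?Xr_gt0 //.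
  exact: dotv_simplex_gt0 y0 (r_simplex sN).
have zU : z s (U n) <= 1 by apply: z_le1 => // i; exact/ltW/U_gt0.
have b1 : beta <= 1 / 8 by have := beta_le; lra.
have := tangent_le_neg_ln beta_gt0 b1 zU (z_U_ge sn) zy.
by rewrite (loss_z sN y0) fhE zB; lra.
Qed.

(** The tangent slopes add up to the directional derivative of [F n] at its regularized minimizer
    [U n], which first-order optimality bounds from below. *)
Lemma sum_loss_ge n y : (n <= N)%N -> simplex y -> (forall i, 0 < y 0 i) ->
  F n (U n) + 4 * B * \sum_i (y 0 i / U n 0 i - 1) <= \sum_(s < n) loss (r s) y.
Proof.
move=> nN ys y0.
have := minimizes_first_order eta_gt0 (U_minimizes n) ys (quadratic_F n (U n) y).
rewrite etaV -(lerD2l (F n (U n))) => /le_trans; apply.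
rewrite F_sum -big_split; apply: ler_sum => s _.
by apply: loss_ge_tangent => //; rewrite ltn_ord.
Qed.

Lemma delta_simplex i : simplex (delta_mx 0 i : 'rV[R]_d).
Proof.
split=> [j|]; first by rewrite mxE ler0n.
rewrite (bigD1 i) //= mxE !eqxx big1 ?addr0 // => j ji.
by rewrite mxE eqxx (negbTE ji).
Qed.

(** First-order optimality towards the vertex [i], where the linear part of the barrier is
    [(U n 0 i)^-1 - d]. With the reset test this makes p polynomially bounded, hence [ln] of p of
    order [ln T]. *)
Lemma U_inv_le n i : (n <= N)%N -> (U n 0 i)^-1 <= d%:R + n%:R / 10.
Proof.
move=> nN; have b0 := beta_gt0; have b1 := beta_le; have B0 := B_gt0.
have := minimizes_first_order eta_gt0 (U_minimizes n) (delta_simplex i)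
  (quadratic_F n (U n) (delta_mx 0 i)).
have -> : \sum_j ((delta_mx 0 i : 'rV[R]_d) 0 j / U n 0 j - 1) = (U n 0 i)^-1 - d%:R.
  rewrite sumrB sumr_const card_ord; congr (_ - _).
  rewrite (bigD1 i) //= mxE !eqxx mul1r big1 ?addr0 // => j ji.
  by rewrite mxE eqxx (negbTE ji) mul0r.
rewrite etaV => H; have {H} : 4 * B * ((U n 0 i)^-1 - d%:R) <= \sum_(s < n) (4 * B / 10).
  apply: (le_trans H); apply: ler_sum => s _; rewrite zB.
  have sN : (s < N)%N := leq_trans (ltn_ord s) nN.
  have h1 : z s (delta_mx 0 i) <= 1 by apply: z_le1 => // j; rewrite mxE ler0n.
  have h2 : - (3 / 4) <= beta * z s (U n) by apply: z_U_ge; rewrite ltn_ord.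
  apply: (@le_trans _ _ ((1 + beta * z s (U n)) * (1 - z s (U n)))).
    by rewrite ler_pM2l; lra.
  rewrite -(ler_pM2l b0).
  have -> : beta * (4 * B / 10) = 4 / 10 * (beta * B) by field.
  rewrite betaB mulrCA mulrBr mulr1; set b := beta * z s _.
  (* By the arithmetic-geometric mean inequality, [(1 + b) * (beta - b) <= (1 + beta) ^+ 2 / 4]. *)
  have : 0 <= ((1 + b) - (beta - b)) ^+ 2 by exact: sqr_ge0.
  by nra.
rewrite sumr_const card_ord -mulr_natr => H.
have : 4 * B * ((U n 0 i)^-1 - d%:R) <= 4 * B * (n%:R / 10) by lra.
by rewrite ler_pM2l ?mulr_gt0 // => ?; lra.
Qed.

Lemma P_le n i : (n < N)%N -> P n 0 i <= 7 * B / 22 * (d%:R + N%:R / 10).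
Proof.
move=> nN; have := nonresetP i (nr nN); have b0 := beta_gt0.
have := U_inv_le i (ltnW nN); have u0 := U_gt0 n i.
have -> : (2 * beta)^-1 = 7 * B / 22 by rewrite invfM betaV; field.
rewrite (mulrC (U n 0 i)) => h1; rewrite -ler_pdivlMr // => h2; apply: (le_trans h2).
have B0 := B_gt0; rewrite ler_pM2l; last by rewrite !mulr_gt0.
apply: (le_trans h1); rewrite lerD2l ler_pM2r // ler_nat; exact: ltnW.
Qed.

(** * The player side: bias, log-determinant and telescoping *)

Lemma bregman_ge_bias n :
  B * dotv (X n.+1) (P n - Pold n)
    <= 2 * B * bregman (X n.+1) (X n)
       + B * \sum_i (ln (P n 0 i) - ln (Pold n 0 i)).
Proof.
rewrite [2 * B]mulrC -mulrA -mulrDr ler_pM2l ?B_gt0 // mulr_sumr -big_split /=.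
apply: ler_sum => i _; rewrite !mxE PE; apply: bias_term_le; try exact: X_gt0.
by case: n => [|n]; [rewrite mxE ltr0n|exact: P_gt0].
Qed.

Lemma bregman_ge_norm n :
  \sum_i (X n.+1 - X n) 0 i ^+ 2 / 4 <= bregman (X n.+1) (X n).
Proof.
apply: ler_sum => i _; rewrite !mxE.
by apply: bregman_term_ge_sqr; rewrite ?X_gt0 ?simplex_le1 //; exact: X_simplex.
Qed.

(* The constant is [B / beta]. *)
Let M n : 'M[R]_d := (7 * B ^+ 2 / 11)%:M + \sum_(s < n) (g s)^T *m (g s)^T^T.

Lemma MS n : M n.+1 = M n + (g n)^T *m (g n)^T^T.
Proof. by rewrite /M big_ord_recr addrA. Qed.

Lemma M_posdef n : posdef (M n).
Proof.
elim: n => [|n IH]; last by rewrite MS; exact: posdefD_outer.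
rewrite /M big_ord0 addr0; apply: posdef_scalar.
by apply: divr_gt0 => //; apply: mulr_gt0 => //; apply: exprn_gt0; exact: B_gt0.
Qed.

Lemma qform_M n y :
  qform (M n) y^T = 7 * B ^+ 2 / 11 * (\sum_i y 0 i ^+ 2) + \sum_(s < n) dotv y (g s) ^+ 2.
Proof.
elim: n => [|n IH].
  rewrite /M !big_ord0 !addr0 /qform trmxK mul_mx_scalar -scalemxAl mxE.
  by rewrite -dotv_mulmx; congr (_ * _); apply: eq_bigr => i _; rewrite expr2.
by rewrite MS qformDl IH qform_outer trmxK -dotv_mulmx big_ord_recr addrA.
Qed.

(** Optimality of [X n] yields [4 * B] times the divergence to [X n.+1]. One half pays the bias; the
    other bounds a squared norm, which together with the squares of all surrogates so far forms
    [beta / 2] times the form of [M n.+1] and absorbs the linear term [z n]. *)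
Lemma ftrl_step n :
  G n (X n) + 4 * B * rbarrier (X n) + loss (r n) (X n)
  <= G n.+1 (X n.+1) + 4 * B * rbarrier (X n.+1)
     + B * \sum_i (ln (P n 0 i) - ln (Pold n 0 i))
     + 7 * B / 22 * (ln (\det (M n.+1)) - ln (\det (M n))).
Proof.
have b0 := beta_gt0; have B0 := B_gt0.
have := minimizes_bregman eta_gt0 (X_minimizes n) (X_simplex n.+1)
  (X_gt0 n.+1) (quadratic_G n (X n) (X n.+1)).
have -> : G n.+1 (X n.+1)
  = G n (X n.+1) + (fh n (X n.+1) - B * dotv (X n.+1) (P n - Pold n)) by [].
have := bregman_ge_bias n; have := bregman_ge_norm n.
have := linear_qform_ge_logdet (g n)^T (X n.+1 - X n)^T (M_posdef n) b0.
rewrite -MS qform_M trmxK -dotv_mulmx big_ord_recr /= etaV fhE -/(z n _).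
have -> : (2 * beta)^-1 = 7 * B / 22 by rewrite invfM betaV; field.
rewrite -mulr_suml; set S := \sum_i _ ^+ 2; set Q := \sum_(s < n) _ ^+ 2.
set D := bregman _ _; set w := z n _; set bi := B * dotv _ _.
(* The multiple of the identity in [M] is [B / beta] so that the norm receives exactly the
   coefficient [B / 2] that the second half of the divergence provides. *)
have -> : beta / 2 * (7 * B ^+ 2 / 11 * S + (Q + w ^+ 2))
    = B / 2 * S + beta / 2 * Q + beta / 2 * w ^+ 2.
  rewrite mulrDr mulrDr addrA; congr (_ + _ + _).
  transitivity (7 * (beta * B) * B / 22 * S); first by field.
  by rewrite betaB; field.
move=> h1 h2 h3 h4.
have h2' : B / 2 * S <= 2 * B * D.
  have : 2 * B * (S / 4) <= 2 * B * D by rewrite ler_pM2l ?mulr_gt0.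
  by lra.
lra.
Qed.

Lemma rbarrier_ge x : simplex x -> (forall i, 0 < x 0 i) -> d%:R * ln d%:R <= rbarrier x.
Proof.
move=> [_ x1] xp; have dR : (0 : R) < d%:R by rewrite ltr0n.
rewrite /rbarrier -sumrN.
have -> : d%:R * ln d%:R = \sum_(i < d) (ln d%:R - d%:R * x 0 i + 1) :> R.
  rewrite big_split sumrB /= -mulr_sumr x1 !sumr_const card_ord mulr1 -[ln _ *+ _]mulr_natl.
  by rewrite subrK.
apply: ler_sum => i _; have := @ln_le_subr1 R (d%:R * x 0 i).
by rewrite mulr_gt0 // => /(_ isT); rewrite lnM ?posrE //; lra.
Qed.

Lemma ftrl n :
  \sum_(s < n) loss (r s) (X s) + 4 * B * (d%:R * ln d%:R)
  <= G n (X n) + 4 * B * rbarrier (X n)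
     + B * \sum_i (ln (Pold n 0 i) - ln (Pold 0 0 i))
     + 7 * B / 22 * (ln (\det (M n)) - ln (\det (M 0))).
Proof.
elim: n => [|n IH].
  rewrite big_ord0 [G 0 _]/(0 : R) !subrr mulr0 addr0 !add0r.
  rewrite big1 => [|i _]; last by rewrite subrr.
  rewrite mulr0 addr0 ler_pM2l ?mulr_gt0 ?B_gt0 //.
  exact: rbarrier_ge (X_simplex 0) (X_gt0 0).
rewrite big_ord_recr /=; have := ftrl_step n.
have -> : \sum_i (ln (Pold n.+1 0 i) - ln (Pold 0 0 i))
  = \sum_i (ln (P n 0 i) - ln (Pold n 0 i)) + \sum_i (ln (Pold n 0 i) - ln (Pold 0 0 i)).
  by rewrite -big_split; apply: eq_bigr => i _ /=; rewrite addrA subrK.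
by rewrite mulrDr; lra.
Qed.

(** The inner product of [X s] and [r s] is at least its [i]-th summand, so the gradient coordinate
    is at most [(X s 0 i)^-1] in absolute value. *)
Lemma g_sqr_le s i K : (s < N)%N -> P s 0 i <= K -> g s 0 i ^+ 2 <= K ^+ 2.
Proof.
move=> sN PK; rewrite gE // mxE mulNr sqrrN; have [r0 _] := r_simplex sN.
have K0 : 0 <= K by apply: le_trans PK; exact/ltW/P_gt0.
have xr := Xr_gt0 sN.
rewrite ler_sqr ?nnegrE //; last by apply: mulr_ge0; [rewrite invr_ge0 ltW|].
apply: (le_trans _ PK); apply: (le_trans _ (P_geV s i)).
rewrite ler_pdivrMl // -ler_pdivrMr ?invr_gt0 ?X_gt0 // invrK.
rewrite /dotv (bigD1 i) //= mulrC lerDl; apply: sumr_ge0 => j _.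
by apply: mulr_ge0 => //; exact/ltW/X_gt0.
Qed.

(** By Hadamard's inequality the determinant is at most the product of the diagonal entries, each at
    most [c + N * K ^+ 2]. *)
Lemma logdet_le K : (forall s i, (s < N)%N -> P s 0 i <= K) ->
  ln (\det (M N)) - ln (\det (M 0)) <= d%:R * ln (1 + N%:R * K ^+ 2 * (11 / (7 * B ^+ 2))).
Proof.
move=> PK; set c := 7 * B ^+ 2 / 11.
have c0 : 0 < c.
  by apply: divr_gt0 => //; apply: mulr_gt0 => //; apply: exprn_gt0; exact: B_gt0.
have -> : 11 / (7 * B ^+ 2) = c^-1 by rewrite /c invf_div.
have /andP[dN dle] := posdef_det (M_posdef N).
have q0 : 0 < 1 + N%:R * K ^+ 2 / c.
  apply: ltr_pwDl => //; apply: divr_ge0; last exact: ltW.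
  by apply: mulr_ge0; [exact: ler0n|exact: sqr_ge0].
have -> : \det (M 0) = c ^+ d by rewrite /M big_ord0 addr0 det_scalar.
have le2 : \det (M N) <= (c * (1 + N%:R * K ^+ 2 / c)) ^+ d.
  apply: (le_trans dle); rewrite -[d in leRHS]card_ord -prodr_const.
  apply: ler_prod => i _; rewrite ltW ?posdef_diag_gt0 //=; last exact: M_posdef.
  rewrite /M mxE mxE eqxx mulr1n mulrDr mulr1 lerD2l mulrC divfK ?gt_eqF //.
  rewrite summxE; apply: (@le_trans _ _ (\sum_(s < N) K ^+ 2)).
    apply: ler_sum => s _; rewrite trmxK mxE big_ord1 [_^T _ _]mxE -expr2.
    by apply: g_sqr_le => //; exact: PK.
  by rewrite sumr_const card_ord -[_ *+ N]mulr_natl.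
have -> : d%:R * ln (1 + N%:R * K ^+ 2 / c)
    = ln ((c * (1 + N%:R * K ^+ 2 / c)) ^+ d) - ln (c ^+ d).
  have cq : 0 < c * (1 + N%:R * K ^+ 2 / c) by exact: mulr_gt0.
  rewrite (lnXn d cq) (lnXn d c0) (@lnM _ c) ?posrE //.
  by rewrite -[(_ + _) *+ d]mulr_natl -[ln c *+ d]mulr_natl; ring.
by rewrite lerD2r ler_ln ?posrE // exprn_gt0 // mulr_gt0.
Qed.

(** * The regret of one epoch and the gain from a reset *)

(** [ftrl] bounds the player's loss by the regularized objective at [X N]; passing from [X N] to
    [U N] gains the divergence, and [G] differs from [F] at [U N] by the bias. [F] at [U N] is then
    cancelled by the lower bound on the comparator's loss. *)
Lemma regret_le_bonus u : simplex u -> (forall i, 0 < u 0 i) ->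
  \sum_(s < N) (loss (r s) (X s) - loss (r s) u)
    <= 4 * B * (rbarrier u - d%:R * ln d%:R)
       + B * \sum_i (ln (Pold N 0 i) - ln (Pold 0 0 i))
       + 7 * B / 22 * (ln (\det (M N)) - ln (\det (M 0)))
       - B * dotv (U N) (Pold N - Pold 0) - 4 * B * bregman (U N) (X N).
Proof.
move=> us u0; rewrite sumrB; have := ftrl N; have := sum_loss_ge (leqnn N) us u0.
have := minimizes_bregman eta_gt0 (X_minimizes N) (U_simplex N)
  (U_gt0 N) (quadratic_G N (X N) (U N)).
have := rbarrier_bregman u0 (U_gt0 N); have := bregman_ge0 u0 (U_gt0 N).
rewrite etaV [G N (U N)]G_sum; set q := beta / 2 * _.
have q0 : 0 <= q.
  rewrite mulr_ge0 ?sumr_ge0 // => [|s _]; last exact: sqr_ge0.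
  by have := beta_gt0; lra.
have B0 := B_gt0.
set S := \sum_i (_ / _ - 1); set D1 := bregman u _ => D10 rE.
have := mulr_ge0 (ltW B0) D10; rewrite rE.
set x2 := 7 * B / 22 * _; set x3 := dotv _ (_ - _); lra.
Qed.

(** A reset makes [U N 0 i * P N 0 i] at least [29 / 100 * B]. If [P N 0 i] is the old maximum, the
    inner product with [Pold N] is already that large; if it is [(X N 0 i)^-1], then
    [U N 0 i / X N 0 i] is large and the divergence takes over. *)
Lemma reset_bonus : (0 < N)%N -> reset_cond eta beta (epoch_state N) ->
  29 / 100 * B <= dotv (U N) (Pold N) + 4 * bregman (U N) (X N).
Proof.
move=> N0 /existsP[i]; rewrite -/(U N) -/(P N) => H.
have B0 := B_gt0; have B20 := B_ge20; have b0 := beta_gt0.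
have p0 := P_gt0 N i; have u0 := U_gt0 N i; have x0 := X_gt0 N i.
have q0 (n : nat) j : 0 < Pold n 0 j.
  by case: n => [|n]; [rewrite mxE ltr0n|exact: P_gt0].
have uP : 29 / 100 * B <= U N 0 i * P N 0 i.
  have : 1 <= 2 * (1 + 6 * eta) * beta * (U N 0 i * P N 0 i).
    by rewrite mulrA -ler_pdivrMr // mul1r.
  have -> : 2 * (1 + 6 * eta) * beta * (U N 0 i * P N 0 i)
     = (22 / (7 * B) + 33 / (7 * B ^+ 2)) * (U N 0 i * P N 0 i).
    by rewrite etaE betaE; field; rewrite gt_eqF.
  set v := U N 0 i * _ => hv; have v0 : 0 < v by rewrite mulr_gt0.
  have h : 22 / (7 * B) + 33 / (7 * B ^+ 2) <= (100 / 29) / B.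
    rewrite -subr_ge0.
    have -> : 100 / 29 / B - (22 / (7 * B) + 33 / (7 * B ^+ 2))
      = (100 / 29 * B - 22 / 7 * B - 33 / 7) / B ^+ 2 by field; rewrite gt_eqF.
    by apply: divr_ge0; [lra|exact: sqr_ge0].
  have := le_trans hv (ler_wpM2r (ltW v0) h).
  by rewrite mulrAC ler_pdivlMr // mul1r; lra.
have dU : U N 0 i * Pold N 0 i <= dotv (U N) (Pold N).
  rewrite /dotv (bigD1 i) //= lerDl; apply: sumr_ge0 => j _.
  by rewrite mulr_ge0 // ltW ?U_gt0.
have D0 := bregman_ge0 (U_gt0 N) (X_gt0 N).
move: uP; rewrite PE; have [_|_] := leP (Pold N 0 i) (X N 0 i)^-1 => uP; last by lra.
have := bregman_ge_term i (U_gt0 N) (X_gt0 N).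
set q := U N 0 i / X N 0 i in uP *; have qp : 0 < q by rewrite divr_gt0.
(* This yields [ln q <= q / 2], so four divergence terms are at least [2 * q - 4], which exceeds [q]
   because [q >= 29 / 5]. *)
have := @ln_le_subr1 R (q / 2); rewrite divr_gt0 // ln_div ?posrE // => /(_ isT).
have : ln 2 <= 1 :> R by have := @ln_le_subr1 R 2; rewrite ltr0n => /(_ isT); lra.
have : 0 <= dotv (U N) (Pold N).
  by apply: dotv_ge0 => j; [exact/ltW/U_gt0|exact/ltW].
by lra.
Qed.

(** In units of [B * d * L], the barrier of [u] costs 4, the growth of the logarithm of p costs 3,
    the log-determinant [49 / 22], and the inner product of [U N] with the initial p at most 1:
    together less than 11. *)
Lemma regret_le u K L : (0 < N)%N -> simplex u -> (forall i, 0 < u 0 i) ->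
  (forall s i, (s < N)%N -> P s 0 i <= K) -> 1 <= L -> rbarrier u <= d%:R * L ->
  ln K <= 3 * L -> ln (1 + N%:R * K ^+ 2 * (11 / (7 * B ^+ 2))) <= 7 * L ->
  \sum_(s < N) (loss (r s) (X s) - loss (r s) u)
    <= 11 * B * d%:R * L - B * (dotv (U N) (Pold N) + 4 * bregman (U N) (X N)).
Proof.
move=> N0 us u0 PK L1 uL KL detL.
apply: (le_trans (regret_le_bonus us u0)).
have B0 := B_gt0; have d1 := d_ge1; have lnd : 0 <= ln d%:R :> R by rewrite ln_ge0.
have dld : 0 <= d%:R * ln d%:R :> R by rewrite mulr_ge0 ?ler0n.
have h1 : \sum_i (ln (Pold N 0 i) - ln (Pold 0 0 i)) <= d%:R * (3 * L).
  apply: (@le_trans _ _ (\sum_(i < d) (3 * L))); last first.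
    by rewrite sumr_const card_ord -[_ *+ d]mulr_natl.
  apply: ler_sum => i _; rewrite [Pold 0 0 i]mxE; apply: le_trans KL.
  have : ln (Pold N 0 i) <= ln K.
    have N1 : N.-1.+1 = N by exact: prednK.
    have PN : Pold N 0 i = P N.-1 0 i by rewrite -{1}N1.
    have PK' : P N.-1 0 i <= K by apply: PK; rewrite N1.
    by rewrite PN ler_ln ?posrE // ?P_gt0 // (lt_le_trans (P_gt0 N.-1 i)).
  lra.
have h2 := le_trans (logdet_le PK) (ler_wpM2l (ler0n R d) detL).
have h3 : dotv (U N) (Pold 0) = d%:R.
  rewrite /dotv; under eq_bigr do rewrite mxE.
  by rewrite -mulr_suml; case: (U_simplex N) => _ ->; rewrite mul1r.
rewrite dotvBr h3; move: h1 h2; set S1 := \sum_i _; set S2 := _ - _.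
move=> h1 h2.
have h1' : B * S1 <= B * (d%:R * (3 * L)) by rewrite ler_pM2l.
have h2' : 7 * B / 22 * S2 <= 7 * B / 22 * (d%:R * (7 * L)).
  by rewrite ler_pM2l // divr_gt0 // mulr_gt0.
have h4 : B * (rbarrier u - d%:R * ln d%:R) <= B * (d%:R * L).
  by rewrite ler_pM2l //; lra.
have Bd : 0 <= B * d%:R by apply: mulr_ge0; [exact: ltW|exact: ler0n].
have h5 : B * d%:R <= B * d%:R * L by rewrite ler_peMr.
have h6 : 0 <= B * d%:R * L by lra.
by lra.
Qed.

End EpochSequence.

(** * From the algorithm with resets to single epochs, and the final constants *)

(** Between two resets the algorithm is [epoch_state] run on shifted returns, so the analysis of a
    single epoch applies to it. *)
Lemma epoch_reduction {R : realType} {d : nat} (B eta beta : R)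
    (r : nat -> 'rV[R]_d) (u : 'rV[R]_d) (a b : nat) :
  ~~ reset_cond eta beta (epoch_init R d) ->
  epoch_from B eta beta r a b ->
  exists (rr : nat -> 'rV[R]_d) (N : nat),
    [/\ (0 < N <= b)%N,
        forall n, (n < N)%N -> exists2 t, (1 <= t <= b)%N & rr n = r t,
        forall n, (n < N)%N -> ~~ reset_cond eta beta (epoch_state B eta beta rr n),
        reset_at B eta beta r b = reset_cond eta beta (epoch_state B eta beta rr N) &
        regret B eta beta r u a b = \sum_(s < N)
          (loss (rr s) (xcur (epoch_state B eta beta rr s)) - loss (rr s) u)].
Proof.
move=> init_nr; case: a => [|a] [ab start nr]; first by [].
have bis0 : bisons B eta beta r a = epoch_init R d.
  case: start => [[->]//|]; clear; case: a => // a.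
  by rewrite /reset_at /= => ->.
(* Here [a] is the predecessor of the first round of the epoch, so [rr 0] belongs to that first
   round and the epoch has [b - a] rounds. *)
pose rr n := r (a + n).+1; pose st := epoch_state B eta beta rr.
have bE : b = (a + (b - a).-1).+1 by lia.
have stE n : (n < b - a)%N -> bisons B eta beta r (a + n) = st n.
  elim: n => [_|n IH nN].
    by rewrite addn0.
  have /negbTE : ~~ reset_at B eta beta r (a + n).+1 by apply: nr; lia.
  by rewrite addnS /reset_at /= IH; [move=> ->|lia].
have resetE n : (n < b - a)%N ->
    reset_at B eta beta r (a + n).+1 = reset_cond eta beta (st n.+1).
  by move=> nN; rewrite /reset_at /= stE.
exists rr, (b - a)%N; split.
- lia.
- by move=> n nN; exists (a + n).+1 => //; lia.
- case=> [//|n] nN; rewrite -/st -resetE; last by lia.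
  by apply: nr; lia.
- rewrite {1}bE resetE; last by lia.
  by rewrite prednK //; lia.
- rewrite /regret -{1}[a.+1]add0n big_addn subSS big_mkord.
  apply: eq_bigr => s _; rewrite /play addnS /= [(s + a)%N]addnC stE //.
Qed.

Lemma rbarrier_le {R : realType} {d : nat} (u : 'rV[R]_d) (t : R) :
  0 < t -> (forall i, t^-1 <= u 0 i) -> rbarrier u <= d%:R * ln t.
Proof.
move=> t0 ut; rewrite /rbarrier -sumrN.
apply: (@le_trans _ _ (\sum_(i < d) ln t)); last first.
  by rewrite sumr_const card_ord -[_ *+ d]mulr_natl.
apply: ler_sum => i _; rewrite lerNl -lnV ?posrE // ler_ln ?posrE ?invr_gt0 //.
by rewrite (lt_le_trans _ (ut i)) // invr_gt0.
Qed.

Lemma epoch_regret_le {R : realType} (d T : nat) (r : nat -> 'rV[R]_d)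
    (u : 'rV[R]_d) (a b : nat) (B eta beta : R) :
  (1 <= d)%N -> (110 * d ^ 2 <= T)%N ->
  (forall t, (1 <= t <= T)%N -> simplex (r t)) ->
  simplex u -> (forall i, T%:R^-1 <= u 0 i) ->
  B = 264 / 5 * d%:R * ln T%:R -> eta = 1 / (4 * B) -> beta = 11 / (7 * B) ->
  (b <= T)%N -> epoch_from B eta beta r a b ->
  regret B eta beta r u a b
    <= 11 * B * d%:R * ln T%:R
       - (if reset_at B eta beta r b then 29 / 100 * B ^+ 2 else 0).
Proof.
move=> d1 Td rs us uT BE etaE betaE bT ep; set L := ln T%:R in BE *.
have dR : (1 : R) <= d%:R by rewrite ler1n.
have TdR : 110 * d%:R ^+ 2 <= T%:R :> R by rewrite -natrX -natrM ler_nat.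
have T110 : 110 <= T%:R :> R by nra.
have T0 : 0 < T%:R :> R by lra.
have TdR' : 110 * d%:R <= T%:R :> R by nra.
have L1 : 1 <= L.
  have h10 : 9 / 10 <= ln 10 :> R.
    by have := @ln_ge_subV R 10; rewrite ltr0n => /(_ isT); lra.
  have : ln (10 * 10) <= L by rewrite ler_ln ?posrE; lra.
  by rewrite lnM ?posrE ?ltr0n //; lra.
have LT : L <= T%:R by have := ln_le_subr1 T0; rewrite -/L; lra.
have dL : d%:R <= d%:R * L by rewrite ler_peMr ?ler0n.
have B20 : 20 * d%:R <= B by rewrite BE; lra.
have B0 : 20 <= B by lra.
have [|rr [N [/andP[N0 Nb] rrE nrs -> ->]]] := epoch_reduction u _ ep.
  exact: (epoch_init_nonreset (fun=> 0) d1 B20 etaE betaE).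
have rrs n : (n < N)%N -> simplex (rr n).
  by move=> /rrE[t tb ->]; apply: rs; lia.
have u0 i : 0 < u 0 i by rewrite (lt_le_trans _ (uT i)) // invr_gt0.
have NT : N%:R <= T%:R :> R by rewrite ler_nat; lia.
(* [P_le] bounds p by a multiple of [B * (d + N / 10)]; since [110 * d <= T] and [ln T <= T], the
   first factor is of order [T ^+ 2] and the second at most [T / 5]. *)
pose K : R := T%:R ^+ 3.
have K0 : 0 <= K by rewrite exprn_ge0.
have PK s i : (s < N)%N -> pcur (epoch_state B eta beta rr s) 0 i <= K.
  move=> sN; apply: (le_trans (P_le d1 B20 etaE betaE rrs nrs i sN)).
  have h1 : d%:R + N%:R / 10 <= T%:R / 5 :> R by lra.
  have h2 : 7 * B / 22 <= 84 / 5 * (T%:R / 110 * T%:R).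
    have : d%:R * L <= T%:R / 110 * T%:R by apply: ler_pM; rewrite ?ler0n //; lra.
    by rewrite BE; lra.
  have h3 : 0 <= d%:R + N%:R / 10 :> R by rewrite addr_ge0 ?divr_ge0 ?ler0n.
  have h4 : 0 <= 7 * B / 22 by lra.
  apply: (le_trans (ler_pM h4 h3 h2 h1)).
  have -> : 84 / 5 * (T%:R / 110 * T%:R) * (T%:R / 5) = 84 / 2750 * K by rewrite /K; field.
  by lra.
have KL : ln K <= 3 * L by rewrite /K lnXn // -[_ *+ 3]mulr_natl -/L lexx.
have detL : ln (1 + N%:R * K ^+ 2 * (11 / (7 * B ^+ 2))) <= 7 * L.
  have -> : 7 * L = ln (T%:R ^+ 7) by rewrite lnXn // -[RHS]mulr_natl -/L.
  have B2 : 400 <= B ^+ 2 by nra.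
  have h1 : 11 / (7 * B ^+ 2) <= 1 / 100 by rewrite ler_pdivrMr; lra.
  have h0 : 0 <= 11 / (7 * B ^+ 2) by apply: divr_ge0; lra.
  have h2 : N%:R * K ^+ 2 <= T%:R ^+ 7.
    have -> : T%:R ^+ 7 = T%:R * K ^+ 2 by rewrite /K; ring.
    by rewrite ler_wpM2r ?sqr_ge0.
  have h3 : 0 <= N%:R * K ^+ 2 by rewrite mulr_ge0 ?ler0n ?sqr_ge0.
  have h4 := ler_pM h3 h0 h2 h1; have h5 := mulr_ge0 h3 h0.
  have h6 : 110 <= T%:R ^+ 7 :> R.
    by rewrite exprS; apply: (le_trans T110); rewrite ler_peMr ?exprn_ege1 //; lra.
  by rewrite ler_ln ?posrE; lra.
have := regret_le d1 B20 etaE betaE rrs nrs N0 us u0 PK L1 (rbarrier_le T0 uT) KL detL.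
move=> /le_trans; apply; rewrite lerD2l lerN2; case: ifPn => [rst|_].
  rewrite expr2 mulrA [_ * B * B]mulrC ler_pM2l; last by lra.
  exact: (reset_bonus d1 B20 etaE betaE N0 rst).
apply: mulr_ge0; first by lra.
have Up := U_gt0 beta rr d1 B20 etaE N; have Xp := X_gt0 beta rr d1 B20 etaE N.
apply: addr_ge0; last by apply: mulr_ge0 => //; exact: bregman_ge0 Up Xp.
apply: dotv_ge0 => i; first exact: ltW.
by rewrite -[N]prednK //; exact/ltW/(P_gt0 B eta beta rr d1).
Qed.

Theorem theorem1 (R : realType) :
  exists C : R, 0 < C /\
  forall (d T : nat) (r : nat -> 'rV[R]_d) (u : 'rV[R]_d),
    (1 <= d)%N ->
    (110 * d ^ 2 <= T)%N ->
    (forall t, (1 <= t <= T)%N -> simplex (r t)) ->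
    simplex u ->
    (forall i, T%:R^-1 <= u 0 i) ->
    let B : R := 264 / 5 * d%:R * ln T%:R in
    let eta : R := 1 / (4 * B) in
    let beta : R := 11 / (7 * B) in
    (forall a b : nat, (b <= T)%N ->
       completed_epoch B eta beta r a b ->
       regret B eta beta r u a b <= 0) /\
    (forall a : nat,
       unfinished_epoch B eta beta r a T ->
       regret B eta beta r u a T <= C * d%:R ^+ 2 * ln T%:R ^+ 2).
Proof.
(* Without a reset the bound is [11 * B * d * ln T], and [11 * 264 / 5 = 580.8]. *)
exists 600; split; first by rewrite ltr0n.
move=> d T r u d1 Td rs us uT B eta beta.
split=> [a b bT [ep rst]|a [ep nrst]].
  have := epoch_regret_le d1 Td rs us uT erefl erefl erefl bT ep.
  rewrite rst => /le_trans H; apply: H; rewrite -/B subr_le0.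
  (* Since [d * ln T = 5 / 264 * B], the first term is [5 / 24 * B ^+ 2], below the gain
     [29 / 100 * B ^+ 2]. *)
  rewrite {1}/B; have dL : 0 <= (d%:R * ln T%:R) ^+ 2 :> R by exact: sqr_ge0.
  by rewrite /B; lra.
have := epoch_regret_le d1 Td rs us uT erefl erefl erefl (leqnn T) ep.
rewrite (negbTE nrst) subr0 => /le_trans H; apply: H.
have dL : 0 <= (d%:R * ln T%:R) ^+ 2 :> R by exact: sqr_ge0.
by rewrite /B; lra.
Qed.
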